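(* Let $\{Q_i\}_{i\in\Lambda}$ be a set of key polynomials for $\nu$, let $i\in\Lambda$ with $i+1\in\Lambda$, and let $h\in K[x]$ satisfy $\nu(h)>\nu_i(h)$. Put $\delta=\delta_i(h)$, and let $h=\sum_jd_{j,i}Q_i^j$ and $h=\sum_jd_{j,i+1}Q_{i+1}^j$ be the $Q_i$-expansion and the $Q_{i+1}$-expansion of $h$. (1) We have $\alpha_{i+1}\delta_{i+1}(h)\le\delta$. (2) If $\delta_{i+1}(h)=\delta$ then $Q_{i+1}=Q_i+z_i$, where $z_i$ is some $Q_i$-free $i$-standard expansion, $\mathrm{in}_ih=\mathrm{in}_\nu d_{\delta,i}\,(\bar Q_i+\mathrm{in}_\nu z_i)^\delta$, and $\mathrm{in}_{i+1}h$ contains the monomial $\mathrm{in}_\nu d_{\delta,i}\,\bar Q_{i+1}^\delta$; in particular, $\mathrm{in}_\nu d_{\delta,i}=\mathrm{in}_\nu d_{\delta,i+1}$. (3) If $\delta_{i+1}(h)=\delta$, then for all $j>\delta$ we have $\nu\left(d_{j,i+1}Q_{i+1}^j\right)-\nu_{i+1}(h)\ge\nu_i^+(h)-\nu_i(h)$.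
   Context: Setting. $K\subset K(x)$ is a simple transcendental extension, $\nu$ a valuation of $K(x)$ with value group $\Gamma$, $\nu_K=\nu|_K$ with value group $\Gamma_0$; $\operatorname{rank}\nu_K=1$, $\nu(x)>0$, $\nu(0)=\infty$. $\tilde\Gamma_0=\Gamma_0\otimes_{\mathbb Z}\mathbb Q$, with a fixed ordered embedding into $\mathbb R$; values are compared in $\Gamma\otimes\mathbb Q$. $\mathbb N$ = positive integers, $\mathbb N_0=\mathbb N\cup\{0\}$. $G_\nu=\bigoplus_{\beta\in\Gamma}\mathbf P_\beta/\mathbf P_{\beta+}$ with $\mathbf P_\beta=\{y\in K(x):\nu(y)\ge\beta\}$, $\mathbf P_{\beta+}=\{y:\nu(y)>\beta\}$; $\mathrm{in}_\nu y$ is the class of $y$ in degree $\nu(y)$; $G_{\nu_K}$ is the analogous algebra for $(K,\nu_K)$. For a graded domain $G$, $G^*=\{g/h: g,h\in G,\ h\ne0 \text{ homogeneous}\}$. Index sets. $\Lambda$ is a countable well ordered set with least element $0$; $i+1$ is the successor of $i$, etc. $(\alpha_i)_{i\in\Lambda}$ are positive integers, $\alpha_0=1$. $i$ is inessential if $i+\omega\in\Lambda$ and $\alpha_{i+t}=1$ for all $t\in\mathbb N_0$. For non-maximal $i$, $i+$ denotes $i+\omega$ if $i$ is inessential, and $i+1$ otherwise (this use of ''$i+$'' alone is distinct from the successor $i+1$). Pre-key polynomials: monic $Q_i\in K[x]$ $(i\in\Lambda)$, $Q_0=x$, with $\deg Q_i=\alpha_i\deg Q_{i_0}$ for all non-maximal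 $i\ge1$ and $i_0<i$ with $i_0+=i$. Put $\beta_i=\nu(Q_i)$, $\bar\alpha_i=\deg_xQ_i$, $\mathbf Q_i=\{Q_q\}_{q<i}$. Standard expansions. An $\ell$-standard monomial is $c\prod_{i\le\ell}Q_i^{\gamma_i}$, $c\in K$, $\gamma_i\in\mathbb N_0$ almost all $0$, with $\gamma_i<\alpha_{i+}$ for $i<\ell$ and, for each inessential $i$, at most one $j$ with $j+=i+$ and $\gamma_j\neq0$ (here $i+$ is computed in $\{q\in\Lambda:q\le\ell\}$). It is $Q_\ell$-free if $\gamma_\ell=0$. A $Q_\ell$-free $\ell$-standard expansion is a finite sum of $Q_\ell$-free $\ell$-standard monomials whose $\nu$-value is the minimum of the values of the monomials. An $\ell$-standard expansion of $g\in K[x]$ is $g=\sum_jc_jQ_\ell^j$ with each $c_j$ a $Q_\ell$-free $\ell$-standard expansion. Set of key polynomials for $\nu$: a set of pre-key polynomials such that (a) $\beta_i\in\tilde\Gamma_0$ for $i\ne\max\Lambda$; (b) if $i\ge1$ has an immediate predecessor, $Q_i$ has an $(i-1)$-standard expansion $Q_i=Q_{i-1}^{\alpha_i}+\sum_{j<\alpha_i}\big(\sum_\gamma c_{j,\gamma}M_\gamma\big)Q_{i-1}^j$ where the $c_{j,\gamma}M_\gamma$ are $Q_{i-1}$-free $(i-1)$-standard monomials ($c_{j,\gamma}\in K$, $M_\gamma$ a product of powers of elements of $\mathbf Q_{i-1}$; elements of $K$ if $i=1$), all the monomials appearing have the same $\nu$-value, and $(\mathrm{in}_\nu Q_{i-1})^{\alpha_i}+\sum_{j}\big(\sum_\gamma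 \mathrm{in}_{\nu_K}c_{j,\gamma}\,\mathrm{in}_\nu M_\gamma\big)(\mathrm{in}_\nu Q_{i-1})^j=0$ is the minimal algebraic relation of $\mathrm{in}_\nu Q_{i-1}$ over $G_{\nu_K}[\mathrm{in}_\nu\mathbf Q_{i-1}]^*$; (c) if $i\geq 1$ has no immediate predecessor, there is $i_0$ with $i_0+=i$, and for every such $i_0$ there is an $i_0$-standard expansion $Q_i=\sum_{j=0}^{\alpha_i}c_{j,i_0}Q_{i_0}^j$; every such expansion satisfies $\nu(Q_i)>\min_j\nu(c_{j,i_0}Q_{i_0}^j)$, and $Q_i$ has the smallest degree among polynomials with this property for all $i_0$ with $i_0+=i$; if $\{\beta_{i'}:i'<i\}$ is bounded in $\tilde\Gamma_0$ (in particular if $i\ne\max\Lambda$) then $c_{\alpha_i,i_0}=1$ and $\min_j\nu(c_{j,i_0}Q_{i_0}^j)=\alpha_i\beta_{i_0}=\nu(c_{0,i_0})$; (d) if for some $n$ the set $\{i:\deg Q_i=n\}$ is infinite, then $\{\nu(Q_i):\deg Q_i=n\}$ is cofinal in $\{\nu(f): f\in K[x]\text{ monic},\deg f=n\}$. Truncations. Each $f\in K[x]$ has a unique $Q_i$-expansion $f=\sum_{j=0}^{s_i}d_{j,i}Q_i^j$ with $\deg d_{j,i}<\deg Q_i$; put $\nu_i(f)=\min_j\{\nu(d_{j,i})+j\beta_i\}$. For $f\ne0$: $S_i(f)=\{j: d_{j,i}\neq 0,\ \nu(d_{j,i})+j\beta_i=\nu_i(f)\}$, $\delta_i(f)=\max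 S_i(f)$, $\mathrm{in}_if=\sum_{j\in S_i(f)}\mathrm{in}_\nu d_{j,i}\,\bar Q_i^j$ where $\bar Q_i$ is a new variable (a polynomial in $\bar Q_i$ over $G_{\nu_K}[\mathrm{in}_\nu\mathbf Q_i]$), and $\nu_i^+(f)=\min\{\nu(d_{j,i}Q_i^j):\delta_i(f)<j\le s_i\}$, with $\nu_i^+(f)=\infty$ if this set is empty. *)

(* Defs.v *)
From HB Require Import structures.
From mathcomp Require Import all_boot all_order all_algebra.
From mathcomp Require Import generic_quotient ring_quotient finmap.
From mathcomp.multinomials Require Import monalg.

Set Implicit Arguments.
Unset Strict Implicit.
Unset Printing Implicit Defensive.

Import Order.TTheory GRing.Theory Num.Theory.
Local Open Scope fset_scope.
Local Open Scope ring_scope.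

HB.mixin Record isOrderedGroup G of Num.POrderedZmodule G := {
  og_total : total (<=%R : rel G);
  og_leD2l : forall c a b : G, a <= b -> c + a <= c + b
}.

#[short(type="oagType")]
HB.structure Definition OrderedGroup :=
  { G of isOrderedGroup G & Num.POrderedZmodule G }.

(* G with a largest, absorbing element [None] adjoined: the value of 0. *)
Definition withInf (G : Type) : Type := option G.

Section WithInf.
Variable G : oagType.
Implicit Types x y z : withInf G.

HB.instance Definition _ := Choice.copy (withInf G) (option G).

Definition fin (a : G) : withInf G := Some a.
Definition infty : withInf G := None.

Definition inf_le x y : bool :=
  match x, y with
  | _, None => true
  | None, Some _ => false
  | Some a, Some b => a <= b
  end.

Definition inf_add x y : withInf G :=
  match x, y with Some a, Some b => fin (a + b) | _, _ => infty end.

(* [x - y], used for finite [y] only. *)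
Definition inf_sub x y : withInf G :=
  match x, y with Some a, Some b => fin (a - b) | _, _ => infty end.

Lemma inf_le_refl : reflexive inf_le.
Proof. by case=> //= a. Qed.

Lemma inf_le_anti : antisymmetric inf_le.
Proof. by case=> [a|] [b|] //= /le_anti ->. Qed.

Lemma inf_le_trans : transitive inf_le.
Proof. by case=> [a|] [b|] [c|] //=; apply: le_trans. Qed.

Lemma inf_le_total : total inf_le.
Proof. by case=> [a|] [b|] //=; apply: og_total. Qed.

HB.instance Definition _ := Order.Le_isPOrder.Build ring_display (withInf G)
  inf_le_refl inf_le_anti inf_le_trans.
HB.instance Definition _ :=
  Order.POrder_isTotal.Build ring_display (withInf G) inf_le_total.

Lemma inf_le_top x : x <= infty.
Proof. by case: x. Qed.

HB.instance Definition _ :=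
  Order.hasTop.Build ring_display (withInf G) inf_le_top.

Lemma inf_addA : associative inf_add.
Proof. by case=> [a|] [b|] [c|] //=; rewrite addrA. Qed.

Lemma inf_addC : commutative inf_add.
Proof. by case=> [a|] [b|] //=; rewrite addrC. Qed.

Lemma inf_add0 : left_id (fin 0) inf_add.
Proof. by case=> [a|] //=; rewrite add0r. Qed.

HB.instance Definition _ :=
  GRing.isNmodule.Build (withInf G) inf_addA inf_addC inf_add0.

Lemma inf_leE (a b : G) : (fin a <= fin b) = (a <= b). Proof. by []. Qed.

Lemma inf_addE (a b : G) : fin a + fin b = fin (a + b). Proof. by []. Qed.

Lemma inf_ltE (a b : G) : (fin a < fin b) = (a < b).
Proof. by rewrite !lt_def inf_leE. Qed.

Lemma inf_leD x y z : x <= y -> z + x <= z + y.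
Proof. by case: x y z => [a|] [b|] [c|] //= ; apply: og_leD2l. Qed.

Lemma inf_ltD (c : G) x y : x < y -> fin c + x < fin c + y.
Proof.
move=> xy; rewrite lt_neqAle inf_leD ?ltW // andbT.
apply: contraTneq xy; case: x y => [a|] [b|] //=; rewrite ?ltxx //.
by rewrite !inf_addE => -[] /addrI ->; rewrite ltxx.
Qed.

Lemma inf_leD2 x y z t : x <= y -> z <= t -> x + z <= y + t.
Proof.
move=> xy zt; apply: (le_trans (inf_leD x zt)).
by rewrite ![_ + t]addrC; apply: inf_leD.
Qed.

Lemma inf_lt_leD (a : G) x y : fin a <= x -> forall b : G, fin b < y ->
  fin (a + b) < x + y.
Proof.
move=> ax b yb; apply: (lt_le_trans (inf_ltD a yb)).
by rewrite ![_ + y]addrC; apply: inf_leD.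
Qed.

End WithInf.

Record valuation (F : fieldType) (G : oagType) := Valuation {
  val_fun :> F -> withInf G;
  val_infty : forall x, val_fun x = infty G <-> x = 0;
  val_mul : forall x y, val_fun (x * y) = val_fun x + val_fun y;
  val_add : forall x y, Num.min (val_fun x) (val_fun y) <= val_fun (x + y)
}.

Section ValuationTheory.
Variables (F : fieldType) (G : oagType) (v : valuation F G).

Lemma val0 : v 0 = infty G. Proof. exact/val_infty. Qed.

Lemma val1 : v 1 = fin 0.
Proof.
case E: (v 1) => [a|].
  have := val_mul v 1 1; rewrite mulr1 E => -[] /eqP.
  by rewrite -subr_eq subrr => /eqP <-.
by have /eqP := (val_infty v 1).1 E; rewrite oner_eq0.
Qed.

Lemma valN1 : v (-1) = fin 0.
Proof.
case E: (v (-1)) => [a|]; last first.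
  by have /eqP := (val_infty v _).1 E; rewrite oppr_eq0 oner_eq0.
have := val_mul v (-1) (-1); rewrite mulrNN mulr1 val1 E => -[] aa.
congr Some; case/orP: (og_total 0 a) => a0; apply/le_anti; rewrite a0 ?andbT /=.
  by have := og_leD2l a _ _ a0; rewrite addr0 -aa.
by have := og_leD2l a _ _ a0; rewrite addr0 -aa.
Qed.

Lemma valN x : v (- x) = v x.
Proof. by rewrite -mulN1r val_mul valN1 add0r. Qed.

Lemma val_addP (b : withInf G) x y : b <= v x -> b <= v y -> b <= v (x + y).
Proof. by move=> bx bby; apply: le_trans (val_add v x y); rewrite le_min bx. Qed.

Lemma val_addPlt (b : withInf G) x y : b < v x -> b < v y -> b < v (x + y).
Proof. by move=> bx bby; apply: lt_le_trans (val_add v x y); rewrite lt_min bx. Qed.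

End ValuationTheory.

Definition grpalg (F : fieldType) (G : oagType) : Type := {malg F[G]}.

Section GroupAlgebra.
Variables (F : fieldType) (G : oagType).
Implicit Types (g : {malg F[G]}) (k l : G).

HB.instance Definition _ := GRing.Zmodule.on (grpalg F G).

Definition ga_one : grpalg F G := << 1 *g (0 : G) >>.

Definition ga_mul (g1 g2 : grpalg F G) : grpalg F G :=
  \sum_(k1 <- msupp g1) \sum_(k2 <- msupp g2)
     << g1@_k1 * g2@_k2 *g (k1 + k2) >>.

Lemma ga_mulw (d1 d2 : {fset G}) g1 g2 :
  msupp g1 `<=` d1 -> msupp g2 `<=` d2 ->
  ga_mul g1 g2 =
    \sum_(k1 <- d1) \sum_(k2 <- d2) << g1@_k1 * g2@_k2 *g (k1 + k2) >>.
Proof.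
move=> le_d1 le_d2; rewrite /ga_mul (big_fset_incl _ le_d1) /=.
  apply/eq_bigr=> k1 _; apply/big_fset_incl => // k _ /mcoeff_outdom ->.
  by rewrite mulr0 monalgU0.
move=> k _ /mcoeff_outdom g1k.
by rewrite big1 => // k' _; rewrite g1k mul0r monalgU0.
Qed.

Lemma ga_mulC : commutative ga_mul.
Proof.
move=> g1 g2; rewrite /ga_mul exchange_big /=.
apply/eq_bigr=> k1 _; apply/eq_bigr=> k2 _.
by rewrite mulrC addrC.
Qed.

Lemma ga_mulUU c1 c2 k1 k2 :
  ga_mul << c1 *g k1 >> << c2 *g k2 >> = << c1 * c2 *g (k1 + k2) >>.
Proof. by rewrite (ga_mulw msuppU_le msuppU_le) !big_seq_fset1 !mcoeffUU. Qed.

Lemma ga_mulDl : left_distributive ga_mul +%R.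
Proof.
move=> g1 g2 g.
rewrite [in RHS](ga_mulw (fsubsetUl _ (msupp g2)) (fsubset_refl _)).
rewrite [in RHS](ga_mulw (fsubsetUr (msupp g1) _) (fsubset_refl _)).
rewrite (ga_mulw (msuppD_le _ _) (fsubset_refl _)).
rewrite -big_split /=; apply/eq_bigr=> k1 _.
rewrite -big_split /=; apply/eq_bigr=> k2 _.
by rewrite mcoeffD mulrDl monalgUD.
Qed.

Lemma ga_mulDr : right_distributive ga_mul +%R.
Proof. by move=> g g1 g2; rewrite ga_mulC ga_mulDl !(ga_mulC g). Qed.

Lemma ga_mul0 : left_zero 0 ga_mul.
Proof. by move=> g; rewrite /ga_mul msupp0 big_seq_fset0. Qed.

Lemma ga_mul0r : right_zero 0 ga_mul.
Proof. by move=> g; rewrite ga_mulC ga_mul0. Qed.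

Lemma ga_mul1 : left_id ga_one ga_mul.
Proof.
move=> g; rewrite (ga_mulw msuppU_le (fsubset_refl _)) big_seq_fset1.
rewrite [RHS]monalgE; apply/eq_bigr=> k _.
by rewrite mcoeffUU mul1r add0r.
Qed.

Lemma ga_mul_suml (I : Type) (r : seq I) (f : I -> grpalg F G) g :
  ga_mul (\sum_(i <- r) f i) g = \sum_(i <- r) ga_mul (f i) g.
Proof. exact: (big_morph (ga_mul^~ g) (fun _ _ => ga_mulDl _ _ _) (ga_mul0 _)). Qed.

Lemma ga_mul_sumr (I : Type) (r : seq I) (f : I -> grpalg F G) g :
  ga_mul g (\sum_(i <- r) f i) = \sum_(i <- r) ga_mul g (f i).
Proof. exact: (big_morph (ga_mul g) (fun _ _ => ga_mulDr _ _ _) (ga_mul0r _)). Qed.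

Lemma ga_mulA : associative ga_mul.
Proof.
move=> g1 g2 g3.
rewrite (monalgE g1) (monalgE g2) (monalgE g3).
rewrite [LHS]ga_mul_suml [X in _ = ga_mul X _]ga_mul_suml [RHS]ga_mul_suml.
apply: eq_bigr => k1 _.
rewrite [X in ga_mul _ X = _]ga_mul_suml [LHS]ga_mul_sumr.
rewrite [X in _ = ga_mul X _]ga_mul_sumr [RHS]ga_mul_suml.
apply: eq_bigr => k2 _.
rewrite [X in ga_mul _ X = _]ga_mul_sumr [LHS]ga_mul_sumr [RHS]ga_mul_sumr.
by apply: eq_bigr => k3 _; rewrite !ga_mulUU mulrA addrA.
Qed.

Lemma ga_one_neq0 : ga_one != 0.
Proof. by rewrite monalgU_eq0 oner_eq0. Qed.

HB.instance Definition _ := GRing.Zmodule_isComNzRing.Build (grpalg F G)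
  ga_mulA ga_mulC ga_mul1 ga_mulDl ga_one_neq0.

End GroupAlgebra.

(** P_b / P_b+ for all b at once: [filt v] is the subring of F[G] whose
    elements have their coefficient of degree b in P_b, [filt_pos v] its ideal
    of elements with coefficient of degree b in P_b+, and [gr v], the direct
    sum of the P_b / P_b+, is the quotient. *)

Section GradedAlgebra.
Variables (F : fieldType) (G : oagType) (v : valuation F G).
Implicit Types (g : grpalg F G).

Definition filt_pred : pred (grpalg F G) :=
  fun g => all (fun b => fin b <= v g@_b) (msupp g).

Lemma filt_predP g : reflect (forall b, fin b <= v g@_b) (filt_pred g).
Proof.
apply: (iffP allP) => [H b|H b _]; last exact: H.
have [/H//|/mcoeff_outdom ->] := boolP (b \in msupp g).
by rewrite val0 inf_le_top.
Qed.

Lemma ga_mcoeffM g1 g2 k : (g1 * g2)@_k =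
  \sum_(k1 <- msupp g1) \sum_(k2 <- msupp g2)
    (g1@_k1 * g2@_k2) *+ (k1 + k2 == k).
Proof.
rewrite [g1 * g2]/(ga_mul g1 g2) raddf_sum /=.
apply/eq_bigr=> k1 _; rewrite raddf_sum /=; apply/eq_bigr=> k2 _.
by rewrite mcoeffU.
Qed.

Lemma ga_mcoeff1 k : (1 : grpalg F G)@_k = (0 == k)%:R.
Proof. exact: mcoeffU. Qed.

Lemma filt_subring : subring_closed filt_pred.
Proof.
split=> [|g1 g2 /filt_predP H1 /filt_predP H2|g1 g2 /filt_predP H1 /filt_predP H2].
- apply/filt_predP => b; rewrite ga_mcoeff1.
  by case: eqP => [<-|_]; rewrite ?val1 // val0 inf_le_top.
- apply/filt_predP => b; rewrite mcoeffB.
  by apply: val_addP => //; rewrite valN.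
- apply/filt_predP => b; rewrite ga_mcoeffM.
  apply: (big_ind (fun z => fin b <= v z)) => [||k1 _]; rewrite ?val0 ?inf_le_top //.
    exact: val_addP.
  apply: (big_ind (fun z => fin b <= v z)) => [||k2 _]; rewrite ?val0 ?inf_le_top //.
    exact: val_addP.
  case: eqP => [<-|_]; last by rewrite mulr0n val0 inf_le_top.
  by rewrite mulr1n val_mul -inf_addE; apply: inf_leD2.
Qed.

HB.instance Definition _ := GRing.isSubringClosed.Build (grpalg F G) filt_pred
  filt_subring.

Record filt : predArgType :=
  Filt { filt_val :> grpalg F G; _ : filt_val \in filt_pred }.

HB.instance Definition _ := [isSub for filt_val].
HB.instance Definition _ := [Choice of filt by <:].
HB.instance Definition _ := [SubChoice_isSubComNzRing of filt by <:].

Definition filt_pos : pred filt :=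
  fun f : filt => all (fun b => fin b < v (filt_val f)@_b) (msupp (filt_val f)).

Lemma filt_posP (g : filt) :
  reflect (forall b, fin b < v (filt_val g)@_b) (filt_pos g).
Proof.
apply: (iffP allP) => [H b|H b _]; last exact: H.
have [/H//|/mcoeff_outdom ->] := boolP (b \in msupp (filt_val g)).
by rewrite val0.
Qed.

Lemma filt_pos_ideal : idealr_closed filt_pos.
Proof.
split=> [||a g1 g2 /(filt_posP g1) H1 /(filt_posP g2) H2].
- by apply/filt_posP => b; rewrite [filt_val _]/(0 : grpalg F G) mcoeff0 val0.
- apply/negP => /filt_posP /(_ 0).
  by rewrite [filt_val _]/(1 : grpalg F G) ga_mcoeff1 eqxx val1 ltxx.
- have /filt_predP Ha := valP a.
  apply/filt_posP => b.
  rewrite [filt_val _]/(filt_val a * filt_val g1 + filt_val g2) mcoeffD.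
  apply: val_addPlt => //; rewrite ga_mcoeffM.
  apply: (big_ind (fun z => fin b < v z)) => [||k1 _]; rewrite ?val0 //.
    exact: val_addPlt.
  apply: (big_ind (fun z => fin b < v z)) => [||k2 _]; rewrite ?val0 //.
    exact: val_addPlt.
  case: eqP => [<-|_]; last by rewrite mulr0n val0.
  by rewrite mulr1n val_mul; apply: inf_lt_leD.
Qed.

HB.instance Definition _ := isIdealr.Build filt filt_pos filt_pos_ideal.

Definition filt_posI : idealr filt := filt_pos.

Definition gr : Type := {ideal_quot filt_posI}.
HB.instance Definition _ := GRing.ComNzRing.on gr.

(* The class of y, for y in P_b, in the component of degree b. *)
Definition homclass (b : G) (y : F) : gr :=
  (\pi_gr (insubd (0 : filt) (<< y *g b >> : grpalg F G)))%qT.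

Definition homogeneous (g : gr) : Prop :=
  exists b y, fin b <= v y /\ g = homclass b y.

Definition init (y : F) : gr := if v y is Some b then homclass b y else 0.

Lemma filtU b y : fin b <= v y -> (<< y *g b >> : grpalg F G) \in filt_pred.
Proof.
move=> by_; apply/filt_predP => c; rewrite mcoeffU.
by case: eqP => [<-|_] //; rewrite mulr0n val0 inf_le_top.
Qed.

Lemma homclassD b x y : fin b <= v x -> fin b <= v y ->
  homclass b (x + y) = homclass b x + homclass b y.
Proof.
move=> bx bY; rewrite /homclass -[RHS]rmorphD; congr (\pi _)%qT.
apply: val_inj; rewrite rmorphD /= !val_insubd !filtU ?monalgUD //.
exact: val_addP.
Qed.

Lemma homclassM b c x y : fin b <= v x -> fin c <= v y ->
  homclass (b + c) (x * y) = homclass b x * homclass c y.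
Proof.
move=> bx cy; rewrite /homclass -[RHS]rmorphM; congr (\pi _)%qT.
apply: val_inj; rewrite rmorphM /= !val_insubd !filtU //.
  by rewrite -[RHS]/(ga_mul _ _) ga_mulUU.
by rewrite val_mul -inf_addE inf_leD2.
Qed.

Lemma homclass_eq0 b y : fin b <= v y -> homclass b y = 0 <-> fin b < v y.
Proof.
move=> bY; set x : filt := insubd (0 : filt) (<< y *g b >> : grpalg F G).
have xE : filt_val x = << y *g b >> by rewrite val_insubd filtU.
have -> : homclass b y = 0 <-> filt_pos x.
  rewrite -[filt_pos x]/(x \in filt_posI).
  have := Quotient.idealrBE filt_posI x 0; rewrite subr0 => ->.
  have -> : (0 : gr) = (\pi_gr (0 : filt))%qT by rewrite rmorph0.
  by split=> [/eqP|/eqP].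
split=> [/filt_posP /(_ b)|H]; first by rewrite xE mcoeffUU.
apply/filt_posP => c; rewrite xE mcoeffU.
by case: eqP => [<-|_] //; rewrite mulr0n val0.
Qed.

Lemma init_eq0 y : init y = 0 <-> y = 0.
Proof.
rewrite /init -(val_infty v); case E: (v y) => [b|] //.
by rewrite homclass_eq0 E ?ltxx ?lexx.
Qed.

Lemma initM x y : init (x * y) = init x * init y.
Proof.
rewrite /init val_mul; case Ex: (v x) => [b|]; last by rewrite mul0r.
case Ey: (v y) => [c|]; last by rewrite mulr0.
by rewrite -homclassM ?Ex ?Ey.
Qed.

End GradedAlgebra.

Inductive subring_gen (R : nzRingType) (S : R -> Prop) : R -> Prop :=
  | subring_gen_in x of S x : subring_gen S x
  | subring_gen_1 : subring_gen S 1
  | subring_genB x y of subring_gen S x & subring_gen S y : subring_gen S (x - y)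
  | subring_genM x y of subring_gen S x & subring_gen S y : subring_gen S (x * y).

Section Relations.
Variables (F : fieldType) (G : oagType) (v : valuation F G).

(* A^* for a graded subring A of G_v. Nonzero homogeneous elements of G_v are
   invertible, init y having the inverse init y^-1, so A^* lies in G_v: its
   element g / h is the unique z such that z h = g. *)
Definition star (A : gr v -> Prop) (z : gr v) : Prop :=
  exists g h, [/\ A g, A h, h <> 0, homogeneous h & z * h = g].

(* r is the monic relation of least degree of a over A. *)
Definition minimal_relation (A : gr v -> Prop) (a : gr v) (r : {poly gr v}) :=
  [/\ r \is monic, forall j, A r`_j, root r a &
      forall s : {poly gr v}, (forall j, A s`_j) -> root s a ->
        (size s < size r)%N -> s = 0].

End Relations.

Section Index.
Context {d : Order.disp_t} {L : bOrderType d}.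
Variable alpha : L -> nat.
Implicit Types (i j k l : L) (U : L -> Prop).

Definition is_succ i j : Prop := (i < j)%O /\ forall k, (i < k -> j <= k)%O.

(* j = i + t *)
Fixpoint is_add i (t : nat) j : Prop :=
  if t is t'.+1 then exists k, is_add i t' k /\ is_succ k j else j = i.

(* j = i + omega *)
Definition is_add_omega i j : Prop :=
  (forall t, exists k, is_add i t k /\ (k < j)%O) /\
  (forall l, (forall t k, is_add i t k -> (k < l)%O) -> (j <= l)%O).

Definition maximal i : Prop := forall j, (j <= i)%O.

(* The next two notions are relative to an initial segment U of L. *)
Definition whole : L -> Prop := fun _ => True.
Definition upto l : L -> Prop := fun q => (q <= l)%O.

Definition inessential U i : Prop :=
  (exists2 j, U j & is_add_omega i j) /\
  (forall t j, is_add i t j -> alpha j = 1%N).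

(* j = i+ *)
Definition is_plus U i j : Prop :=
  U j /\ ((inessential U i /\ is_add_omega i j) \/
          (~ inessential U i /\ is_succ i j)).

End Index.

Definition well_ordered {d : Order.disp_t} (L : porderType d) : Prop :=
  forall P : L -> Prop, (exists i, P i) ->
    exists2 i, P i & forall j, P j -> (i <= j)%O.

Definition countable_type (L : Type) : Prop := exists f : L -> nat, injective f.

Section BaseGroup.
Variables (K : fieldType) (G : oagType) (v : valuation {fraction {poly K}} G).

Definition valp (p : {poly K}) : withInf G := v (FracField.tofrac p).
Definition inp (p : {poly K}) : gr v := init v (FracField.tofrac p).

Definition base_group (b : G) : Prop := exists c : K, valp c%:P = fin b.

(* b belongs to the group of values of K tensored with Q. *)
Definition base_group_Q (b : G) : Prop :=
  exists2 n, (0 < n)%N & base_group (b *+ n).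

(* H is an isolated (convex) subgroup of the group of values of K. *)
Definition isolated_subgroup (H : G -> Prop) : Prop :=
  [/\ forall a, H a -> base_group a, H 0,
      forall a b, H a -> H b -> H (a - b) &
      forall a b, base_group a -> 0 <= a <= b -> H b -> H a].

(* {0} is the only isolated subgroup other than the whole group. *)
Definition base_rank1 : Prop :=
  (exists2 b, base_group b & b <> 0) /\
  forall H, isolated_subgroup H ->
    (forall b, H b -> b = 0) \/ (forall b, base_group b -> H b).

End BaseGroup.

(* c`_0 Q^0 + c`_1 Q^1 + ... *)
Definition comb (K : fieldType) (q : {poly K}) (c : seq {poly K}) : {poly K} :=
  \sum_(j < size c) c`_j * q ^+ j.

Section KeyPolynomials.
Context {K : fieldType} {G : oagType}.
Variable v : valuation {fraction {poly K}} G.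
Context {d : Order.disp_t} {L : bOrderType d}.
Variables (alpha : L -> nat) (Q : L -> {poly K}).
Implicit Types (i l : L) (p f q : {poly K}) (c : seq {poly K}).

Local Notation nu := (valp v).
Local Notation expo := {fsfun L -> nat with 0%N}.
Local Notation mono := (K * expo)%type.

(* b_i is the value of Q_i; finite, as Q_i is monic. *)
Local Notation beta i := (nu (Q i)).

Record pre_key_polynomials : Prop := PreKeyPolynomials {
  pk_monic : forall i, Q i \is monic;
  pk_bot : Q \bot%O = 'X;
  pk_alpha_gt0 : forall i, (0 < alpha i)%N;
  pk_alpha_bot : alpha \bot%O = 1%N;
  pk_degree : forall i i0, ~ maximal i -> (\bot < i)%O -> (i0 < i)%O ->
    is_plus alpha whole i0 i ->
    (size (Q i)).-1 = (alpha i * (size (Q i0)).-1)%N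
}.

(* The monomial c * prod_i Q_i^(g i) is given as the pair (c, g). *)
Definition Qprod (g : expo) : {poly K} := \prod_(i <- finsupp g) Q i ^+ g i.
Definition monom (m : mono) : {poly K} := m.1%:P * Qprod m.2.

Definition standard l (g : expo) : Prop :=
  [/\ forall i, g i <> 0%N -> (i <= l)%O,
      forall i i', (i < l)%O -> is_plus alpha (upto l) i i' ->
        (g i < alpha i')%N &
      forall i i' j k, inessential alpha (upto l) i ->
        is_plus alpha (upto l) i i' ->
        is_plus alpha (upto l) j i' -> is_plus alpha (upto l) k i' ->
        g j <> 0%N -> g k <> 0%N -> j = k].

Definition free_standard l (g : expo) : Prop := standard l g /\ g l = 0%N.

Definition sum_monom (s : seq mono) : {poly K} := \sum_(m <- s) monom m.

(* s is a Q_l-free l-standard expansion, as a formal sum of monomials with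
   distinct exponents. *)
Definition free_expansion l (s : seq mono) : Prop :=
  [/\ uniq (unzip2 s), forall m, m \in s -> free_standard l m.2 &
      nu (sum_monom s) = \big[Num.min / \top%O]_(m <- s) nu (monom m)].

Definition is_free_expansion l p : Prop :=
  exists2 s, free_expansion l s & p = sum_monom s.

(* f = sum_j c`_j Q_l^j is an l-standard expansion. *)
Definition expansion l c f : Prop :=
  (forall j, (j < size c)%N -> is_free_expansion l c`_j) /\ f = comb (Q l) c.

Definition min_value l c : withInf G :=
  \big[Num.min / \top%O]_(j < size c) nu (c`_j * Q l ^+ j).

(* G_{v_K}[in Q_j, j < i], as a subring of G_v; G_{v_K} embeds in G_v by
   in_{v_K} c |-> in_v c. *)
Definition init_alg i : gr v -> Prop :=
  subring_gen (fun g => (exists c : K, g = inp v c%:P) \/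
                        (exists2 j, (j < i)%O & g = inp v (Q j))).

Definition relation_poly i' (a : nat) (s : nat -> seq mono) : {poly gr v} :=
  'X^a + \sum_(j < a)
    (\sum_(m <- s j) inp v m.1%:P * inp v (Qprod m.2))%:P * 'X^j.

(* i' is the immediate predecessor of i. *)
Definition successor_condition i' i : Prop :=
  exists s : nat -> seq mono,
  [/\ forall j, (j < alpha i)%N -> free_expansion i' (s j),
      Q i = Q i' ^+ alpha i + \sum_(j < alpha i) sum_monom (s j) * Q i' ^+ j,
      forall j m, (j < alpha i)%N -> m \in s j -> m.1 <> 0 ->
        nu (monom m * Q i' ^+ j) = nu (Q i' ^+ alpha i) &
      minimal_relation (star (init_alg i')) (inp v (Q i'))
        (relation_poly i' (alpha i) s)].

(* The value of f exceeds the minimum over its i0-standard expansion. *)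
Definition value_jumps i0 f : Prop :=
  (exists c, expansion i0 c f) /\
  (forall c, expansion i0 c f -> min_value i0 c < nu f).

(* {b_i' : i' < i} is bounded in the group of values of K tensored with Q,
   with bound g / n. *)
Definition values_bounded i : Prop :=
  exists g n, [/\ base_group v g, (0 < n)%N &
    forall i', (i' < i)%O -> beta i' *+ n <= fin g].

Definition limit_condition i : Prop :=
  [/\ exists i0, is_plus alpha whole i0 i,
      forall i0, is_plus alpha whole i0 i ->
        exists2 c, size c = (alpha i).+1 & expansion i0 c (Q i),
      forall i0, is_plus alpha whole i0 i -> value_jumps i0 (Q i),
      forall f, (forall i0, is_plus alpha whole i0 i -> value_jumps i0 f) ->
        (size (Q i) <= size f)%N &
      values_bounded i \/ ~ maximal i ->
      forall i0 c, is_plus alpha whole i0 i -> size c = (alpha i).+1 ->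
        expansion i0 c (Q i) ->
        [/\ c`_(alpha i) = 1, min_value i0 c = beta i0 *+ alpha i &
            beta i0 *+ alpha i = nu c`_0]].

Record key_polynomials : Prop := KeyPolynomials {
  kp_pre : pre_key_polynomials;
  kp_torsion : forall i, ~ maximal i ->
    exists2 b, beta i = fin b & base_group_Q v b;
  kp_successor : forall i' i, is_succ i' i -> successor_condition i' i;
  kp_limit : forall i, (\bot < i)%O -> (forall i', ~ is_succ i' i) ->
    limit_condition i;
  kp_cofinal : forall n,
    (forall s : seq L, exists2 i, i \notin s & (size (Q i)).-1 = n) ->
    forall f, f \is monic -> (size f).-1 = n ->
    exists2 i, (size (Q i)).-1 = n & nu f <= beta i
}.

(* The coefficient of q^j in the q-expansion of f, which is 0 for
   j >= size f; see [qexp_sum], [qexp_size] and [qexp_unique]. *)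
Definition qexp (q f : {poly K}) (j : nat) : {poly K} := (f %/ q ^+ j) %% q.

Lemma qexp_size q f j : q != 0 -> (size (qexp q f j) < size q)%N.
Proof. by move=> q0; rewrite ltn_modp. Qed.

Lemma qexp_sum q f : (1 < size q)%N ->
  f = \sum_(j < size f) qexp q f j * q ^+ j.
Proof.
move=> q1; have q0 : q != 0 by rewrite -size_poly_gt0 ltnW.
have H n : f = \sum_(j < n) qexp q f j * q ^+ j + (f %/ q ^+ n) * q ^+ n.
  elim: n => [|n IH]; first by rewrite big_ord0 add0r expr0 divp1 mulr1.
  rewrite {1}IH big_ord_recr /= -addrA; congr (_ + _).
  rewrite {1}(divp_eq (f %/ q ^+ n) q) mulrDl addrC; congr (_ + _).
  by rewrite divp_divl -exprSr exprS mulrA.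
rewrite {1}(H (size f)) [f %/ _]divp_small ?mul0r ?addr0 //.
have := size_exp q (size f) => E.
apply: (@leq_trans ((size q).-1 * size f).+1).
  by rewrite ltnS leq_pmull // -subn1 subn_gt0.
by rewrite -E prednK // size_poly_gt0 expf_neq0.
Qed.

Lemma qexp_unique q (n : nat) (e : nat -> {poly K}) : (1 < size q)%N ->
  (forall j, (size (e j) < size q)%N) ->
  forall j, (j < n)%N -> qexp q (\sum_(k < n) e k * q ^+ k) j = e j.
Proof.
move=> q1 eq; have q0 : q != 0 by rewrite -size_poly_gt0 ltnW.
have H m (g : nat -> {poly K}) : (\sum_(k < m.+1) g k * q ^+ k) =
           g 0%N + (\sum_(k < m) g k.+1 * q ^+ k) * q.
  rewrite big_ord_recl expr0 mulr1 mulr_suml; congr (_ + _).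
  by apply: eq_bigr => k _; rewrite -mulrA -exprSr.
elim: n e eq => // n IH e eq [|j] jn; rewrite H /qexp.
  by rewrite expr0 divp1 modpD modp_mull addr0 modp_small.
rewrite exprS -divp_divl divpD mulpK //.
rewrite [e 0%N %/ q]divp_small // add0r.
exact: (IH (fun k => e k.+1)).
Qed.

Local Notation dcoef i f j := (qexp (Q i) f j).

Definition truncation i f : withInf G :=
  \big[Num.min / \top%O]_(j < size f) (nu (dcoef i f j) + beta i *+ j).

Definition in_support i f (j : nat) : bool :=
  (dcoef i f j != 0) && (nu (dcoef i f j) + beta i *+ j == truncation i f).

Definition delta i f : nat := \max_(j < size f | in_support i f j) j.

Definition trunc_init i f : {poly gr v} :=
  \sum_(j < size f | in_support i f j) (inp v (dcoef i f j))%:P * 'X^j.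

Definition truncation_plus i f : withInf G :=
  \big[Num.min / \top%O]_(j < size f | (delta i f < j)%N)
    nu (dcoef i f j * Q i ^+ j).

End KeyPolynomials.

(* Main.v *)
(* Let q = Q_i, r = Q_(i+1), a = alpha_(i+1), and let rho = in_i r, a monic
   polynomial of degree a: it is the minimal relation of in_nu q.

   By transfinite induction over the indices, q is an abstract key polynomial:
   if f, g have degree less than deg q and f g = s q + t with deg t < deg q,
   then nu (s q) > nu (f g).  Hence the truncation nu_i is multiplicative and
   f |-> in_i f is compatible with products.  By minimality of rho, nu agrees
   with nu_i on all polynomials of degree less than deg r.

   Now expand h = sum_j e_j r^j.  Taking the initial forms in_i gives
   in_i h = sum_j (in_i e_j) rho^j, over those j for which
   nu (e_j) + j a beta_i is minimal, and deg (in_i e_j) < a.  If J is the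
   largest such j, then delta_i (h) >= a J; and since nu r > a beta_i the terms
   with j > J cannot become minimal for nu_(i+1), so delta_(i+1) (h) <= J.
   If the two deltas agree, the jump of nu at h makes them positive, so a = 1,
   rho is linear, and no j < J contributes to in_i h, which therefore is a
   constant times rho^J. *)
Require Import Defs.
From Stdlib Require Import Classical ClassicalEpsilon.
From mathcomp Require Import all_boot all_order all_algebra.
From mathcomp Require Import generic_quotient ring_quotient finmap.
From mathcomp Require Import zify.

Set Implicit Arguments.
Unset Strict Implicit.
Unset Printing Implicit Defensive.

Import Order.TTheory GRing.Theory Num.Theory.
Local Open Scope ring_scope.

(** * Values with infinity *)

(** Everything is read in a fixed degree: [gpoly] is meaningful for a degree [b] and an [f] whose
    truncation is at least [b], and it vanishes when the truncation is larger. In this form initial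
    forms add and multiply without a case distinction for cancelling terms.

    Minimality of the relation speaks only of coefficients in the algebra generated by the initial
    forms of earlier key polynomials. Hence the induction has to carry along that the polynomials of
    degree below [Q l] are exactly the free standard expansions; this is the purpose of the
    combinatorics of standard exponents. At a limit there is no immediate predecessor: each
    polynomial of lower degree is exact at some earlier index, and exactness must be shown to
    persist along a run of key polynomials of equal degree.

    For (3), let [ep] be the excess of [nu r] over [a beta_i]. In the expansion at [r], the [j]-th
    term gains [j ep] over its truncated value, and if the deltas agree then [nu_(i+1) h] exceeds
    [nu_i h] by [delta ep]. A term with [j > delta] gains more than that. *)

Section WithInfOrder.
Variable G : oagType.
Implicit Types (b c : G) (x y z : withInf G).

Lemma inf_leD2lE c x y : (fin c + x <= fin c + y) = (x <= y).
Proof.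
case: (leP x y) => [xy|yx]; first by rewrite inf_leD.
by apply/negbTE; rewrite -ltNge inf_ltD.
Qed.

Lemma inf_ltD2lE c x y : (fin c + x < fin c + y) = (x < y).
Proof. by rewrite !ltNge inf_leD2lE. Qed.

Lemma inf_leD2rE c x y : (x + fin c <= y + fin c) = (x <= y).
Proof. by rewrite ![_ + fin c]addrC inf_leD2lE. Qed.

Lemma inf_ltD2rE c x y : (x + fin c < y + fin c) = (x < y).
Proof. by rewrite !ltNge inf_leD2rE. Qed.

Lemma fin_mulrn b n : fin b *+ n = fin (b *+ n).
Proof. by elim: n => // n IH; rewrite !mulrS IH. Qed.

Lemma fin_leB b c x : (fin (b - c) <= x) = (fin b <= x + fin c).
Proof. by rewrite -(inf_leD2rE c) inf_addE subrK. Qed.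

Lemma fin_ltB b c x : (fin (b - c) < x) = (fin b < x + fin c).
Proof. by rewrite -(inf_ltD2rE c) inf_addE subrK. Qed.

Lemma fin_lt_neq b x : (fin b < x) = (fin b <= x) && (x != fin b).
Proof. by rewrite lt_def andbC. Qed.

Lemma inf_fin_or x : x <> infty G -> exists b, x = fin b.
Proof. by case: x => [b|] // _; exists b. Qed.

Lemma inf_leMn x y n : x <= y -> x *+ n <= y *+ n.
Proof. by move=> xy; elim: n => // n IH; rewrite !mulrS inf_leD2. Qed.

Lemma fin_ltMn b c n : (0 < n)%N -> fin b < fin c -> fin (b *+ n) < fin (c *+ n).
Proof.
case: n => // n _ bc; elim: n => // n IH.
rewrite mulrS [c *+ _]mulrS; apply: (lt_le_trans (y := fin (c + b *+ n.+1))).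
  by rewrite -!inf_addE inf_ltD2rE.
by rewrite -!inf_addE inf_leD2lE ltW.
Qed.

End WithInfOrder.

Lemma min_attained (G : oagType) (F : nat -> withInf G) n k c :
  F k = fin c -> (forall j, (n <= j)%N -> F j = infty G) ->
  exists b m, F m = fin b /\ forall j, fin b <= F j.
Proof.
move=> kc Fn; have kn : (k < n)%N.
  by rewrite ltnNge; apply/negP => /Fn; rewrite kc.
pose m := [arg min_(i < Ordinal kn) (F i)]%O.
have mle j : F m <= F j.
  case: (ltnP j n) => [jn|/Fn ->]; last by rewrite inf_le_top.
  by rewrite /m; case: arg_minP => // i _ /(_ (Ordinal jn)); apply.
have [b mb] : exists b, F m = fin b.
  by have := mle k; rewrite kc; case: (F m) => [b|] // _; exists b.
by exists b, m; split=> // j; rewrite -mb.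
Qed.

(** * Valuations and classes of homogeneous elements *)

Section ValuationFacts.
Variables (F : fieldType) (G : oagType) (v : valuation F G).

Lemma valX x n : v (x ^+ n) = v x *+ n.
Proof.
elim: n => [|n IH]; first by rewrite expr0 Defs.val1 mulr0n.
by rewrite exprS val_mul IH mulrS.
Qed.

Lemma val_sum I (r : seq I) (P : pred I) (f : I -> F) b :
  (forall i, P i -> b <= v (f i)) -> b <= v (\sum_(i <- r | P i) f i).
Proof.
move=> H; apply: (big_ind (fun x => b <= v x)) => //.
  by rewrite val0 inf_le_top.
exact: val_addP.
Qed.

Lemma val_addl x y : v x < v y -> v (x + y) = v x.
Proof.
move=> xy; apply/le_anti/andP; split; last by rewrite val_addP // ltW.
rewrite leNgt; apply/negP => H.
have vy : v x < v (- y) by rewrite valN.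
by have := val_addPlt H vy; rewrite addrK ltxx.
Qed.

Lemma homclass_init b y : v y = fin b -> homclass v b y = init v y.
Proof. by rewrite /init => ->. Qed.

Lemma homclass_neq0 b y : v y = fin b -> homclass v b y != 0.
Proof.
move=> yb; apply/eqP; rewrite homclass_init // init_eq0 -(val_infty v).
by rewrite yb.
Qed.

Lemma homclass1 : homclass v 0 1 = 1.
Proof.
have -> : (1 : gr v) = (\pi_(gr v) (1 : filt v))%qT by rewrite rmorph1.
congr (\pi _)%qT; apply: val_inj.
by rewrite val_insubd filtU ?Defs.val1.
Qed.

Lemma homclass_gt b y : fin b < v y -> homclass v b y = 0.
Proof. by move=> H; apply/homclass_eq0=> //; apply: ltW. Qed.

Lemma homclass_neq0P b y : fin b <= v y -> homclass v b y != 0 -> v y = fin b.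
Proof.
move=> bY; apply: contra_neq_eq => /eqP yb; apply: homclass_gt.
by rewrite fin_lt_neq bY; apply/eqP.
Qed.

Lemma homclass0 b : homclass v b 0 = 0.
Proof. by apply: homclass_gt; rewrite val0. Qed.

Lemma homclass_sum b I (r : seq I) (P : pred I) (f : I -> F) :
  (forall i, P i -> fin b <= v (f i)) ->
  homclass v b (\sum_(i <- r | P i) f i) = \sum_(i <- r | P i) homclass v b (f i).
Proof.
move=> H; suff [] : fin b <= v (\sum_(i <- r | P i) f i) /\
  homclass v b (\sum_(i <- r | P i) f i) = \sum_(i <- r | P i) homclass v b (f i) by [].
elim/big_rec2: _ => [|i y x Pi [bx <-]]; first by rewrite val0 homclass0 inf_le_top.
by split; [apply: val_addP => //; apply: H | rewrite homclassD ?H].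
Qed.

End ValuationFacts.

Section PolyValuation.
Context {K : fieldType} {G : oagType}.
Variable v : valuation {fraction {poly K}} G.
Implicit Types (f g q r : {poly K}) (b c : G).
Local Notation nu := (valp v).
Local Notation hom b f := (homclass v b (FracField.tofrac f)).

Lemma valp0 : nu 0 = infty G. Proof. by rewrite /valp rmorph0 val0. Qed.
Lemma valp1 : nu 1 = fin 0. Proof. by rewrite /valp rmorph1 Defs.val1. Qed.

Lemma valp_eq0 f : nu f = infty G <-> f = 0.
Proof.
rewrite /valp (val_infty v); split=> [/eqP|->]; last by rewrite rmorph0.
by rewrite tofrac_eq0 => /eqP.
Qed.

Lemma valp_fin f : f != 0 -> exists b, nu f = fin b.
Proof. by move=> /eqP f0; apply: inf_fin_or; rewrite valp_eq0. Qed.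

Lemma valpM f g : nu (f * g) = nu f + nu g.
Proof. by rewrite /valp rmorphM val_mul. Qed.

Lemma valpX f n : nu (f ^+ n) = nu f *+ n.
Proof. by rewrite /valp rmorphXn valX. Qed.

Lemma valpN f : nu (- f) = nu f.
Proof. by rewrite /valp rmorphN valN. Qed.

Lemma valpD f g (x : withInf G) : x <= nu f -> x <= nu g -> x <= nu (f + g).
Proof. by rewrite /valp rmorphD; apply: val_addP. Qed.

Lemma valp_addl f g : nu f < nu g -> nu (f + g) = nu f.
Proof. by rewrite /valp rmorphD; apply: val_addl. Qed.

Lemma valpB f g (x : withInf G) : x <= nu f -> x <= nu g -> x <= nu (f - g).
Proof. by move=> xf xg; apply: valpD; rewrite ?valpN. Qed.

Lemma valp_sum I (r : seq I) (P : pred I) (f : I -> {poly K}) (x : withInf G) :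
  (forall i, P i -> x <= nu (f i)) -> x <= nu (\sum_(i <- r | P i) f i).
Proof. by move=> H; rewrite /valp rmorph_sum; apply: val_sum. Qed.

Lemma homp0 b : hom b 0 = 0. Proof. by rewrite rmorph0 homclass0. Qed.

Lemma hompD b f g : fin b <= nu f -> fin b <= nu g ->
  hom b (f + g) = hom b f + hom b g.
Proof. by move=> ? ?; rewrite rmorphD homclassD. Qed.

Lemma hompM b c f g : fin b <= nu f -> fin c <= nu g ->
  hom (b + c) (f * g) = hom b f * hom c g.
Proof. by move=> ? ?; rewrite rmorphM homclassM. Qed.

Lemma hompXn b f n : fin b <= nu f -> hom (b *+ n) (f ^+ n) = hom b f ^+ n.
Proof.
move=> bf; elim: n => [|n IH].
  by rewrite mulr0n !expr0 rmorph1 homclass1.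
by rewrite mulrS !exprS hompM ?IH // valpX -fin_mulrn inf_leMn.
Qed.

Lemma homp_inp b f : nu f = fin b -> hom b f = inp v f.
Proof. exact: homclass_init. Qed.

Lemma inp_neq0 f : f != 0 -> inp v f != 0.
Proof. by move=> /valp_fin[b fb]; rewrite -(homp_inp fb) homclass_neq0. Qed.

End PolyValuation.

(** * Expansions and truncations *)

Section QExpansion.
Context {K : fieldType}.
Implicit Types (f g q r : {poly K}).

Lemma qexpD q f g j : qexp q (f + g) j = qexp q f j + qexp q g j.
Proof. by rewrite /qexp divpD modpD. Qed.

Lemma qexp0 q j : qexp q 0 j = 0.
Proof. by rewrite /qexp div0p mod0p. Qed.

Lemma qexp_addsum q I (s : seq I) (P : pred I) (F : I -> {poly K}) j :
  qexp q (\sum_(i <- s | P i) F i) j = \sum_(i <- s | P i) qexp q (F i) j.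
Proof.
apply: (big_morph (fun f => qexp q f j)); last exact: qexp0.
by move=> x y; rewrite qexpD.
Qed.

Variable q : {poly K}.
Hypothesis q1 : (1 < size q)%N.

Lemma qexp_small f j a : (size f <= ((size q).-1 * a))%N -> (a <= j)%N ->
  qexp q f j = 0.
Proof.
move=> fa aj; rewrite /qexp divp_small ?mod0p //.
have q0 : q != 0 by rewrite -size_poly_gt0 ltnW.
have E := size_exp q j.
rewrite -(prednK (n := size (q ^+ j))) ?size_poly_gt0 ?expf_neq0 // E ltnS.
by rewrite (leq_trans fa) // leq_mul2l aj orbT.
Qed.

Lemma qexp_big f j : (size f <= j)%N -> qexp q f j = 0.
Proof. by apply: qexp_small; rewrite leq_pmull // -subn1 subn_gt0. Qed.

Lemma size_qexp f j : (size (qexp q f j) < size q)%N.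
Proof. by rewrite qexp_size // -size_poly_gt0 ltnW. Qed.

Lemma qexp_sum_wide f n : (forall j, (n <= j)%N -> qexp q f j = 0) ->
  f = \sum_(j < n) qexp q f j * q ^+ j.
Proof.
move=> H; rewrite {1}(qexp_sum f q1).
pose F j := qexp q f j * q ^+ j.
rewrite -(big_mkord xpredT F) -[RHS](big_mkord xpredT F).
have F0 m k : (forall j, (m <= j)%N -> qexp q f j = 0) -> (m <= k)%N ->
    \sum_(0 <= j < k) F j = \sum_(0 <= j < m) F j.
  move=> Fm mk; rewrite (big_cat_nat (leq0n m) mk) /= [X in _ + X]big_nat_cond.
  rewrite [X in _ + X]big1 ?addr0 // => j /andP[/andP[mj _] _].
  by rewrite /F Fm ?mul0r.
case: (leqP (size f) n) => [fn|/ltnW nf]; last exact: F0.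
by rewrite (F0 _ _ _ fn) // => j; apply: qexp_big.
Qed.

Lemma qexp_sumE n (e : nat -> {poly K}) j :
  (forall k, (k < n)%N -> (size (e k) < size q)%N) ->
  qexp q (\sum_(k < n) e k * q ^+ k) j = if (j < n)%N then e j else 0.
Proof.
move=> en; pose e' k := if (k < n)%N then e k else 0.
have e's k : (size (e' k) < size q)%N.
  by rewrite /e'; case: ifP => [/en//|_]; rewrite size_poly0 ltnW.
(* The sum is padded with zero coefficients, since [qexp_unique] reads off only indices below the
   length of the sum. *)
have -> : \sum_(k < n) e k * q ^+ k = \sum_(k < maxn n j.+1) e' k * q ^+ k.
  rewrite (big_ord_widen_cond _ (fun=> true) (fun k => e k * q ^+ k) (leq_maxl n j.+1)).
  rewrite big_mkcond; apply: eq_bigr => k _ /=; rewrite /e'.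
  by case: ifP => //; rewrite mul0r.
by rewrite (qexp_unique q1 e's) // leq_max ltnSn orbT.
Qed.

Lemma qexp_mono f k j : (size f < size q)%N ->
  qexp q (f * q ^+ k) j = if j == k then f else 0.
Proof.
move=> fq; pose e i := if i == k then f else 0.
have -> : f * q ^+ k = \sum_(i < k.+1) e i * q ^+ i.
  rewrite (bigD1 ord_max) //= /e eqxx big1 ?addr0 // => i ik.
  by rewrite (_ : (i : nat) == k = false) ?mul0r //; apply/negbTE.
rewrite qexp_sumE => [|i _]; last first.
  by rewrite /e; case: eqP => // _; rewrite size_poly0 ltnW.
by rewrite /e ltnS; case: eqP => [->|_]; rewrite ?leqnn ?if_same.
Qed.

Lemma qexp_neq0 f : f != 0 -> exists j, qexp q f j != 0.
Proof.
move=> f0; case: (boolP [exists j : 'I_(size f), qexp q f j != 0]).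
  by case/existsP => j; exists j.
move/existsPn => H; case/negP: f0; apply/eqP; rewrite (qexp_sum f q1) big1 // => j _.
by have /negPn/eqP -> := H j; rewrite mul0r.
Qed.

End QExpansion.

(** The degree of [f * g] is at most twice that of [q] minus 2. So division by [q] already gives the
    whole [q]-expansion of the product, the quotient being its coefficient at [q ^+ 1]. *)
Lemma size_divp_mul (K : fieldType) (f g q : {poly K}) : (1 < size q)%N ->
  (size f < size q)%N -> (size g < size q)%N -> (size ((f * g) %/ q)%R < size q)%N.
Proof.
move=> q1 fq gq; have q0 : q != 0 by rewrite -size_poly_gt0 ltnW.
rewrite size_divp //.
have H x y z t : (1 < t -> x < t -> y < t -> z <= (x + y).-1 -> z - t.-1 < t)%N by lia.
exact: H q1 fq gq (size_polyMleq f g).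
Qed.

(** * Truncation at a polynomial and its graded algebra *)

Section Truncation.
Context {K : fieldType} {G : oagType}.
Variable v : valuation {fraction {poly K}} G.
Implicit Types (f g q r : {poly K}) (b c : G).
Local Notation nu := (valp v).
Local Notation hom b f := (homclass v b (FracField.tofrac f)).

Definition term_value q f j : withInf G := nu (qexp q f j) + nu q *+ j.

(* The truncation of [nu] at [q] takes a value at least [x] at [f]. *)
Definition trunc_ge q (x : withInf G) f := forall j, x <= term_value q f j.

(** By [trunc_ge_val] the truncation at a nonconstant [q] never exceeds [nu], so this inequality
    makes the two agree at [f]. *)
Definition exact q f := trunc_ge q (nu f) f.

(* The defining property of an abstract key polynomial, in the form which
   makes the truncation at [q] multiplicative: reducing a product modulo [q]
   only drops a part of higher value. *)
Definition is_key q := forall f g, f != 0 -> g != 0 ->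
  (size f < size q)%N -> (size g < size q)%N ->
  nu (f * g) < nu ((f * g) %/ q * q).

Lemma term_valueE q f j : term_value q f j = nu (qexp q f j * q ^+ j).
Proof. by rewrite valpM valpX. Qed.

Section FixedQ.
Variables (q : {poly K}) (be : G).
Hypothesis q1 : (1 < size q)%N.
Hypothesis q_be : nu q = fin be.
Local Notation ge := (trunc_ge q).

(* The component of degree [b] of the image of [f] in the graded algebra of
   the truncation at [q], as a polynomial in the class of [q]. *)
Definition gpoly b f : {poly gr v} :=
  \poly_(j < size f) hom (b - be *+ j) (qexp q f j).

Lemma trunc_ge_val x f : ge x f -> x <= nu f.
Proof.
move=> H; rewrite (qexp_sum f q1); apply: valp_sum => j _.
by rewrite -term_valueE.
Qed.

Lemma trunc_ge_le x y f : x <= y -> ge y f -> ge x f.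
Proof. by move=> xy H j; apply: le_trans (H j). Qed.

Lemma trunc_ge0 x : ge x 0.
Proof. by move=> j; rewrite /term_value qexp0 valp0 /= inf_le_top. Qed.

Lemma trunc_geD x f g : ge x f -> ge x g -> ge x (f + g).
Proof.
move=> xf xg j; rewrite term_valueE qexpD mulrDl.
by apply: valpD; rewrite -term_valueE.
Qed.

Lemma trunc_geN x f : ge x f -> ge x (- f).
Proof. by move=> xf j; rewrite /term_value /qexp divpN modpN valpN; apply: xf. Qed.

Lemma trunc_ge_mono x f k : (size f < size q)%N ->
  (ge x (f * q ^+ k) <-> x <= nu f + nu q *+ k).
Proof.
move=> fq; split=> [/(_ k)|H j]; first by rewrite /term_value qexp_mono ?eqxx.
rewrite /term_value qexp_mono //; case: eqP => [->//|_].
by rewrite valp0 inf_le_top.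
Qed.

Lemma trunc_ge_fin b f j : ge (fin b) f -> fin (b - be *+ j) <= nu (qexp q f j).
Proof. by move=> /(_ j); rewrite fin_leB -fin_mulrn -q_be. Qed.

Lemma coef_gpoly b f j : (gpoly b f)`_j = hom (b - be *+ j) (qexp q f j).
Proof.
rewrite coef_poly; case: ltnP => // fj.
by rewrite (qexp_big q1) // homp0.
Qed.

Lemma gpolyD b f g : ge (fin b) f -> ge (fin b) g ->
  gpoly b (f + g) = gpoly b f + gpoly b g.
Proof.
move=> bf bg; apply/polyP => j; rewrite coefD !coef_gpoly qexpD.
by rewrite hompD //; apply: trunc_ge_fin.
Qed.

Lemma gpoly0 b : gpoly b 0 = 0.
Proof. by apply/polyP => j; rewrite coef_gpoly qexp0 homp0 coef0. Qed.

Lemma gpoly_sum b I (s : seq I) (P : pred I) (F : I -> {poly K}) :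
  (forall i, P i -> ge (fin b) (F i)) ->
  ge (fin b) (\sum_(i <- s | P i) F i) /\
  gpoly b (\sum_(i <- s | P i) F i) = \sum_(i <- s | P i) gpoly b (F i).
Proof.
move=> H; elim/big_rec2: _ => [|i y x Pi [bx <-]].
  by split; [exact: trunc_ge0 | rewrite gpoly0].
by split; [apply: trunc_geD => //; apply: H | rewrite gpolyD //; apply: H].
Qed.

Lemma gpoly_mono b f k : (size f < size q)%N ->
  gpoly b (f * q ^+ k) = (hom (b - be *+ k) f)%:P * 'X^k.
Proof.
move=> fq; apply/polyP => j; rewrite coef_gpoly qexp_mono // coefCM coefXn.
by case: eqP => [->|_]; rewrite ?mulr1 // homp0 mulr0.
Qed.

Lemma gpoly_eq0 b f : ge (fin b) f -> 
  (gpoly b f = 0 <-> forall j, fin b < term_value q f j).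
Proof.
move=> bf; split=> [H j|H].
  have := congr1 (fun p : {poly gr v} => p`_j) H; rewrite coef0 coef_gpoly.
  rewrite homclass_eq0; last exact: trunc_ge_fin.
  by rewrite [v _]/(nu _) fin_ltB -fin_mulrn -q_be.
apply/polyP => j; rewrite coef_gpoly coef0 homclass_gt //.
by rewrite [v _]/(nu _) fin_ltB -fin_mulrn -q_be; apply: H.
Qed.

Lemma gpoly_lt b c f : b < c -> ge (fin c) f -> gpoly b f = 0.
Proof.
move=> bc cf; have bc' : fin b < fin c by rewrite inf_ltE.
apply/gpoly_eq0 => [|j]; first exact: trunc_ge_le (ltW bc') cf.
exact: lt_le_trans bc' (cf j).
Qed.

Lemma gpoly_coef_neq0 b f j : ge (fin b) f -> (gpoly b f)`_j != 0 ->
  term_value q f j = fin b.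
Proof.
move=> bf; rewrite coef_gpoly => /homclass_neq0P E.
have {}E : nu (qexp q f j) = fin (b - be *+ j) by apply: E (trunc_ge_fin j bf).
by rewrite /term_value E q_be fin_mulrn inf_addE subrK.
Qed.

Lemma coef_gpoly_inp b f j : term_value q f j = fin b ->
  (gpoly b f)`_j = inp v (qexp q f j).
Proof.
rewrite /term_value q_be fin_mulrn coef_gpoly.
case E: (nu (qexp q f j)) => [c|] //; rewrite inf_addE => -[<-].
by rewrite addrK homp_inp.
Qed.

Lemma gpoly_attained b f j : term_value q f j = fin b -> gpoly b f != 0.
Proof.
move=> E; apply/eqP => H.
have := coef_gpoly_inp E; rewrite H coef0 => /esym/eqP; apply/negP.
apply: inp_neq0; apply: contra_eqN E => /eqP z.
by rewrite /term_value z valp0.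
Qed.

(** Substituting [inp v q] for the variable is the map from the graded algebra of the truncation to
    [gr v]. Hence [inp v q] is a root of [gpoly b f] exactly when the value of [f] exceeds [b]. *)
Lemma horner_gpoly b f : ge (fin b) f -> (gpoly b f).[inp v q] = hom b f.
Proof.
move=> bf; rewrite {2}(qexp_sum f q1) horner_poly raddf_sum homclass_sum.
  apply: eq_bigr => j _; rewrite -(homp_inp q_be) -hompXn ?q_be //.
  rewrite -hompM ?subrK //; first exact: trunc_ge_fin.
  by rewrite valpX q_be fin_mulrn.
by move=> j _; have := bf j; rewrite term_valueE.
Qed.

(** This pair of conditions is how the exact truncation of [f] is expressed from here on;
    [gpoly_trunc_unique] shows that it determines [b]. *)
Lemma trunc_attained f : f != 0 -> exists b, ge (fin b) f /\ gpoly b f != 0.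
Proof.
move=> f0; have [k fk] := qexp_neq0 q1 f0.
have [c fc] := valp_fin v fk.
have kc : term_value q f k = fin (c + be *+ k).
  by rewrite /term_value fc q_be fin_mulrn.
have [j /(qexp_big q1) z|b [m [mb mle]]] := min_attained (n := size f) kc.
  by rewrite /term_value z valp0.
by exists b; split; last exact: gpoly_attained mb.
Qed.

Lemma gpoly_trunc_unique b c f : ge (fin b) f -> gpoly b f != 0 ->
  ge (fin c) f -> gpoly c f != 0 -> b = c.
Proof.
move=> bf fb cf fc; case: (ltgtP (fin b) (fin c)) => [| |[]//]; rewrite inf_ltE.
  by move=> /gpoly_lt/(_ cf) E; rewrite E eqxx in fb.
by move=> /gpoly_lt/(_ bf) E; rewrite E eqxx in fc.
Qed.

(** Nonzero homogeneous classes have nonzero products. Knowing the leading coefficient as such a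
    class thus does the work of integrality of [gr v] in [gpolyM_neq0]. *)
Lemma lead_coef_gpoly b f : ge (fin b) f -> gpoly b f != 0 ->
  exists c y, lead_coef (gpoly b f) = hom c y /\ nu y = fin c.
Proof.
move=> bf p0; pose n := (size (gpoly b f)).-1.
exists (b - be *+ n), (qexp q f n); rewrite lead_coefE coef_gpoly; split=> //.
apply: homclass_neq0P; first exact: trunc_ge_fin.
by rewrite -coef_gpoly -lead_coefE lead_coef_eq0.
Qed.

Hypothesis q_key : is_key q.

(* In [f g = s q + r] the term [s q] disappears in degree [b + c], by the
   key property. *)
Lemma gpoly_mono_mul b c f g j k :
  (size f < size q)%N -> (size g < size q)%N ->
  fin b <= nu f + nu q *+ j -> fin c <= nu g + nu q *+ k ->
  ge (fin (b + c)) (f * q ^+ j * (g * q ^+ k)) /\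
  gpoly (b + c) (f * q ^+ j * (g * q ^+ k)) =
  gpoly b (f * q ^+ j) * gpoly c (g * q ^+ k).
Proof.
move=> fq gq bf cg; have [->|f0] := eqVneq f 0.
  by rewrite !mul0r !gpoly0 mul0r; split=> //; apply: trunc_ge0.
have [->|g0] := eqVneq g 0.
  by rewrite mul0r !mulr0 !gpoly0 mulr0; split=> //; apply: trunc_ge0.
have q0 : q != 0 by rewrite -size_poly_gt0 ltnW.
set s := (f * g) %/ q; set r := (f * g) %% q.
have fgE : f * g = s * q + r by apply: divp_eq.
have sr : nu (f * g) < nu (s * q) by apply: q_key.
have rq : (size r < size q)%N by rewrite ltn_modp.
have sq : (size s < size q)%N by apply: size_divp_mul.
have fg_le : fin (b + c) <= nu (f * g) + nu q *+ (j + k).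
  by rewrite mulrnDr valpM addrACA -inf_addE; apply: inf_leD2.
have r_val : nu r = nu (f * g).
  rewrite (_ : r = f * g - s * q); last by rewrite fgE addrC addKr.
  by apply: valp_addl; rewrite valpN.
have -> : f * q ^+ j * (g * q ^+ k) = r * q ^+ (j + k) + s * q ^+ (j + k).+1.
  by rewrite mulrACA -exprD exprS mulrA -mulrDl fgE addrC.
have ge_r : ge (fin (b + c)) (r * q ^+ (j + k)) by rewrite trunc_ge_mono // r_val.
have lt_s : fin (b + c) < nu s + nu q *+ (j + k).+1.
  rewrite mulrS addrA -valpM; apply: le_lt_trans fg_le _.
  by rewrite q_be fin_mulrn inf_ltD2rE.
have ge_s : ge (fin (b + c)) (s * q ^+ (j + k).+1) by rewrite trunc_ge_mono // ltW.
split; first exact: trunc_geD.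
have s0 : gpoly (b + c) (s * q ^+ (j + k).+1) = 0.
  rewrite gpoly_mono // homclass_gt ?mul0r //.
  by rewrite [v _]/(nu _) fin_ltB -fin_mulrn -q_be.
rewrite (gpolyD ge_r ge_s) s0 addr0.
rewrite (gpoly_mono b j fq) (gpoly_mono c k gq) (gpoly_mono (b + c) (j + k) rq).
have fb : fin (b - be *+ j) <= nu f by rewrite fin_leB -fin_mulrn -q_be.
have gc : fin (c - be *+ k) <= nu g by rewrite fin_leB -fin_mulrn -q_be.
have bcE : b - be *+ j + (c - be *+ k) = b + c - be *+ (j + k).
  by rewrite addrACA -opprD -mulrnDr.
have -> : hom (b + c - be *+ (j + k)) r = hom (b - be *+ j) f * hom (c - be *+ k) g.
  rewrite -hompM // bcE.
  have -> : r = f * g - s * q by rewrite fgE addrC addKr.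
  have lt_sq : fin (b + c - be *+ (j + k)) < nu (s * q).
    rewrite fin_ltB -fin_mulrn -q_be; apply: le_lt_trans fg_le _.
    by rewrite q_be fin_mulrn inf_ltD2rE.
  rewrite -(valpN v) in lt_sq.
  rewrite hompD ?(ltW lt_sq) //; last by rewrite fin_leB -fin_mulrn -q_be.
  by rewrite [X in _ + X]homclass_gt ?addr0.
rewrite polyCM exprD; exact: mulrACA.
Qed.

(** By bilinearity from the products of two terms of the expansions. Arbitrary lower bounds [b] and
    [c] are allowed, so sums of products can be treated termwise. *)
Lemma gpolyM b c f g : ge (fin b) f -> ge (fin c) g ->
  ge (fin (b + c)) (f * g) /\ gpoly (b + c) (f * g) = gpoly b f * gpoly c g.
Proof.
move=> bf cg.
have H (j k : nat) := gpoly_mono_mul (size_qexp q1 f j) (size_qexp q1 g k) (bf j) (cg k).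
have mono x h : ge (fin x) h -> gpoly x h = \sum_(j < size h) gpoly x (qexp q h j * q ^+ j).
  move=> xh; rewrite {1}(qexp_sum h q1).
  apply: (gpoly_sum _ _).2 => j _; apply/trunc_ge_mono; [exact: size_qexp | exact: xh].
have -> : f * g = \sum_(j < size f) \sum_(k < size g)
    qexp q f j * q ^+ j * (qexp q g k * q ^+ k).
  by rewrite {1}(qexp_sum f q1) {1}(qexp_sum g q1) big_distrlr.
rewrite (mono b f bf) (mono c g cg) big_distrlr /=.
have H2 (j : nat) := gpoly_sum (index_enum 'I_(size g)) (P := xpredT)
  (F := fun k => qexp q f j * q ^+ j * (qexp q g k * q ^+ k)) (b := b + c)
  (fun k _ => (H j k).1).
have [H3 ->] := gpoly_sum (index_enum 'I_(size f)) (P := xpredT) (b := b + c)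
  (fun j _ => (H2 j).1).
split=> //; apply: eq_bigr => j _; rewrite (H2 j).2.
by apply: eq_bigr => k _; rewrite (H j k).2.
Qed.

Lemma gpolyM_neq0 b c f g : ge (fin b) f -> ge (fin c) g ->
  gpoly b f != 0 -> gpoly c g != 0 -> gpoly (b + c) (f * g) != 0.
Proof.
move=> bf cg f0 g0; rewrite (gpolyM bf cg).2.
have [x [y [fE yx]]] := lead_coef_gpoly bf f0.
have [x' [y' [gE yx']]] := lead_coef_gpoly cg g0.
have nz : lead_coef (gpoly b f) * lead_coef (gpoly c g) != 0.
  rewrite fE gE -hompM ?yx ?yx' // homclass_neq0 //.
  by have := valpM v y y'; rewrite yx yx'.
by rewrite -lead_coef_eq0 lead_coef_proper_mul.
Qed.

Lemma gpolyXn b f n : ge (fin b) f ->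
  ge (fin (b *+ n)) (f ^+ n) /\ gpoly (b *+ n) (f ^+ n) = gpoly b f ^+ n.
Proof.
move=> bf; elim: n => [|n [IH1 IH2]].
  have s1 : (size (1%R : {poly K}) < size q)%N by rewrite size_poly1.
  have E : (1 : {poly K}) = 1 * q ^+ 0 by rewrite expr0 mulr1.
  rewrite mulr0n !expr0; split.
    by rewrite E; apply/(trunc_ge_mono _ _ s1); rewrite valp1 mulr0n addr0.
  by rewrite E gpoly_mono // subr0 expr0 mulr1 rmorph1 homclass1.
by rewrite !mulrS !exprS -IH2; apply: gpolyM.
Qed.

End FixedQ.
End Truncation.

Lemma size_monic_sub (K : fieldType) (q r : {poly K}) : q \is monic -> r \is monic ->
  size q = size r -> (1 < size r)%N -> (size (q - r)%R < size r)%N.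
Proof.
move=> qm rm qr r1; rewrite -(prednK (ltnW r1)) ltnS.
apply/leq_sizeP => j; rewrite leq_eqVlt coefB => /orP[/eqP <-|jr].
  by rewrite -{1}qr -!lead_coefE (monicP qm) (monicP rm) subrr.
by rewrite !nth_default ?subrr ?qr // -(prednK (ltnW r1)).
Qed.

Lemma size_mul_monic_exp (R : nzRingType) (rho p : {poly R}) a j :
  rho \is monic -> size rho = a.+1 -> p != 0 ->
  size (p * rho ^+ j) = (size p + a * j)%N.
Proof.
move=> rm ra p0; elim: j => [|j IH]; first by rewrite expr0 mulr1 muln0 addn0.
rewrite exprSr mulrA size_Mmonic ?IH ?ra ?mulnS ?addnS /=; first by lia.
  by rewrite -size_poly_gt0 IH ltn_addr // size_poly_gt0.
by [].
Qed.

(** Whatever cancels among the terms with [j < J], they have degree below [a * J], while the top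
    term has degree at least [a * J]. *)
Lemma size_sum_monic_powers (R : nzRingType) (rho : {poly R}) a (P : nat -> {poly R}) J :
  rho \is monic -> size rho = a.+1 -> (forall j, (size (P j) <= a)%N) -> P J != 0 ->
  size (\sum_(j < J.+1) P j * rho ^+ j) = (size (P J) + a * J)%N.
Proof.
move=> rm ra Pa PJ.
have sM p j (p0 : p != 0) := size_mul_monic_exp j rm ra p0.
rewrite big_ord_recr /= addrC size_polyDl sM //.
have : (size (\sum_(i < J) P i * rho ^+ i)%R <= a * J)%N.
  apply: leq_trans (size_sum _ _ _) _; apply/bigmax_leqP => i _.
  have [->|Pi] := eqVneq (P i) 0; first by rewrite mul0r size_poly0.
  rewrite sM //; apply: leq_trans (_ : a + a * i <= _)%N; first by rewrite leq_add2r.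
  by rewrite -mulnS leq_mul2l ltn_ord orbT.
by move=> H; rewrite (leq_ltn_trans H) // -[X in (X < _)%N]add0n ltn_add2r size_poly_gt0.
Qed.

(** * Inheritance of the key property and comparison of truncations *)

Section KeyStep.
Context {K : fieldType} {G : oagType}.
Variable v : valuation {fraction {poly K}} G.
Implicit Types (f g h q r : {poly K}) (b c : G).
Local Notation nu := (valp v).
Local Notation hom b f := (homclass v b (FracField.tofrac f)).

Lemma exact_gpoly q be b f : (1 < size q)%N -> nu q = fin be ->
  exact v q f -> nu f = fin b -> gpoly v q be b f != 0.
Proof.
move=> q1 qb ef fb.
have f0 : f != 0 by apply: contra_eqN fb => /eqP ->; rewrite valp0.
have [c [cf fc]] := trunc_attained q1 qb f0.
suff -> : b = c by [].
have := trunc_ge_val q1 cf; rewrite fb le_eqVlt inf_ltE => /orP[/eqP[]//|cb].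
by move: fc; rewrite (gpoly_lt q1 qb cb) ?eqxx // -fb.
Qed.

(* If [nu (s r)] did not exceed [nu (f g)], where [f g = s r + t], then all
   of [f], [g], [t], hence [s r], would have truncation at [q] at least
   [nu (s r)]; but the truncation at [q] is a valuation which agrees with [nu]
   on [s] and is smaller on [r]. *)
Lemma is_key_step r : (1 < size r)%N ->
  (forall f g h h', (size f < size r)%N -> (size g < size r)%N ->
     (size h < size r)%N -> (size h' < size r)%N ->
     exists q be, [/\ (1 < size q)%N, nu q = fin be, is_key v q &
       ~ exact v q r] /\
       [/\ exact v q f, exact v q g, exact v q h & exact v q h']) ->
  is_key v r.
Proof.
move=> r1 H f g f0 g0 fr gr.
set s := (f * g) %/ r; set t := (f * g) %% r.
have r0 : r != 0 by rewrite -size_poly_gt0 ltnW.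
have sr : (size s < size r)%N by apply: size_divp_mul.
have tr : (size t < size r)%N by rewrite ltn_modp.
(* [q] may depend on these four polynomials: at a limit it is chosen after them, far enough to be
   exact on all four. *)
have [q [be [[q1 qb qk qr] [ef eg es et]]]] := H f g s t fr gr sr tr.
have fgE : f * g = s * r + t by apply: divp_eq.
rewrite ltNge; apply/negP => le_fg.
have [b0 fb] := valp_fin v f0; have [c0 gc] := valp_fin v g0.
have [x rx] := valp_fin v r0.
have s0 : s != 0.
  apply: contraTneq le_fg => ->; rewrite mul0r valp0 valpM fb gc.
  by rewrite -ltNge.
have [c sc] := valp_fin v s0.
have [b [br rb]] := trunc_attained q1 qb r0.
have bx : b < x.
  have := trunc_ge_val q1 br; rewrite rx le_eqVlt inf_ltE => /orP[/eqP[E]|//].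
  by case: qr; rewrite /exact rx -E.
have nusr : nu (s * r) = fin (c + x) by rewrite valpM sc rx.
have ge_fg : trunc_ge v q (nu (s * r)) (f * g).
  apply: trunc_ge_le le_fg _; rewrite valpM fb gc.
  by apply: (gpolyM q1 qb qk _ _).1; [rewrite -fb | rewrite -gc].
have ge_t : trunc_ge v q (nu (s * r)) t.
  apply: trunc_ge_le et; rewrite (_ : t = f * g - s * r); last first.
    by rewrite fgE addrC addKr.
  exact: valpB.
have ge_sr : trunc_ge v q (fin (c + x)) (s * r).
  have E : s * r = f * g - t by rewrite fgE addrK.
  by rewrite -nusr {2}E; apply: trunc_geD ge_fg (trunc_geN ge_t).
have cs : trunc_ge v q (fin c) s by rewrite -sc.
have := gpolyM_neq0 q1 qb qk cs br (exact_gpoly q1 qb es sc) rb.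
rewrite (gpoly_lt q1 qb _ ge_sr) ?eqxx //.
by rewrite -inf_ltE -!inf_addE inf_ltD2lE inf_ltE.
Qed.

(* Expand [f] in powers of [q = q' + (q - q')], where both summands have
   truncation at [q'] at least [nu q]. *)
Lemma trunc_ge_same_size q q' be b f : q \is monic -> q' \is monic ->
  size q = size q' -> (1 < size q)%N -> nu q = fin be -> is_key v q' ->
  nu q <= nu q' -> trunc_ge v q (fin b) f -> trunc_ge v q' (fin b) f.
Proof.
move=> qm qm' qq q1 qb qk le_q bf.
have q1' : (1 < size q')%N by rewrite -qq.
have q0' : q' != 0 by rewrite -size_poly_gt0 ltnW.
have [be' qb'] := valp_fin v q0'.
have ge_q : trunc_ge v q' (fin be) q.
  rewrite -[q](subrK q'); apply: trunc_geD; rewrite -qb.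
    rewrite -[q - q']mulr1 -(expr0 q'); apply/trunc_ge_mono => //.
      exact: size_monic_sub.
    by rewrite addr0; apply: valpB.
  have E : q' = 1 * q' ^+ 1 by rewrite expr1 mul1r.
  rewrite {2}E; apply/(trunc_ge_mono v q1'); first by rewrite size_poly1.
  by rewrite valp1 add0r.
rewrite (qexp_sum f q1); apply: (gpoly_sum q1' qb' (P := xpredT) _ _).1 => j _.
rewrite -(subrK (be *+ j) b); apply: (gpolyM q1' qb' qk _ _).1; last first.
  exact: (gpolyXn q1' qb' qk _ ge_q).1.
rewrite -[qexp _ _ _]mulr1 -(expr0 q'); apply/trunc_ge_mono => //.
  by rewrite -qq size_qexp.
by rewrite addr0; apply: trunc_ge_fin.
Qed.

Lemma exact_same_size q q' f : q \is monic -> q' \is monic ->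
  size q = size q' -> (1 < size q)%N -> is_key v q' ->
  nu q <= nu q' -> exact v q f -> exact v q' f.
Proof.
move=> qm qm' qq q1 qk le_q ef.
have [->|f0] := eqVneq f 0; first exact: trunc_ge0.
have q0 : q != 0 by rewrite -size_poly_gt0 ltnW.
have [be qb] := valp_fin v q0; have [b fb] := valp_fin v f0.
by rewrite /exact fb; apply: (trunc_ge_same_size qm qm' qq q1 qb qk le_q); rewrite -fb.
Qed.

End KeyStep.

(** * Passing from a key polynomial to the next one *)

Section NextKey.
Context {K : fieldType} {G : oagType}.
Variable v : valuation {fraction {poly K}} G.
Implicit Types (f g h : {poly K}) (b c : G).
Local Notation nu := (valp v).
Local Notation hom b f := (homclass v b (FracField.tofrac f)).

Variables (q r : {poly K}) (be be' : G) (a : nat).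
Hypotheses (q1 : (1 < size q)%N) (q_be : nu q = fin be) (q_key : is_key v q).
Hypotheses (a0 : (0 < a)%N) (r_size : size r = ((size q).-1 * a).+1).
Hypotheses (r_be' : nu r = fin be') (be_lt : be *+ a < be').
Hypothesis r_ge : trunc_ge v q (fin (be *+ a)) r.
Let rho := gpoly v q be (be *+ a) r.
Hypotheses (rho_monic : rho \is monic) (rho_size : size rho = a.+1).
Hypothesis r_exact : forall f, (size f < size r)%N -> exact v q f.

(* [W] is the value of the [j]-th term of the [r]-expansion, computed with
   the truncated value [be *+ a] of [r] instead of its larger value [be']. *)
Let W h j : withInf G := nu (qexp r h j) + fin (be *+ a *+ j).
(** The gain of [nu r] over its truncation at [q]. By [term_W], passing from [W] to the terms at [r]
    adds [ep *+ j], a handicap growing with [j], on which all comparisons of the two deltas rest. *)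
Let ep := be' - be *+ a.

Let r1 : (1 < size r)%N.
Proof. by rewrite r_size ltnS muln_gt0 a0 -subn1 subn_gt0 q1. Qed.

Let be'E : be' = be *+ a + ep.
Proof. by rewrite /ep addrC subrK. Qed.

Let ep0 : fin 0 < fin ep.
Proof. by rewrite -(inf_ltD2rE (be *+ a)) !inf_addE add0r addrC -be'E inf_ltE. Qed.

Let ep_le m n : (m <= n)%N -> fin (ep *+ m) <= fin (ep *+ n).
Proof.
move=> mn; rewrite -(subnKC mn) mulrnDr -inf_addE -{1}[fin (ep *+ m)]addr0.
rewrite inf_leD2lE -fin_mulrn; apply: le_trans (inf_leMn (n - m) (ltW ep0)).
by rewrite fin_mulrn mul0rn.
Qed.

Let ep_lt m n : (m < n)%N -> fin (ep *+ m) < fin (ep *+ n).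
Proof.
move=> mn; rewrite -(subnKC (ltnW mn)) mulrnDr -inf_addE -{1}[fin (ep *+ m)]addr0.
rewrite inf_ltD2lE -[X in X < _](mul0rn _ (n - m)).
by rewrite fin_mulrn; apply: fin_ltMn; rewrite ?subn_gt0.
Qed.

Let term_W h j : term_value v r h j = W h j + fin (ep *+ j).
Proof. by rewrite /term_value /W r_be' be'E fin_mulrn mulrnDl -inf_addE addrA. Qed.

Let W_big h j : (size h <= j)%N -> W h j = infty G.
Proof. by move=> /(qexp_big r1) z; rewrite /W z valp0. Qed.

(** The initial form at [q] of a coefficient at [r], in the degree left over from [mu] once
    [rho ^+ j] has taken [be *+ a *+ j]. *)
Let P h mu j := gpoly v q be (mu - be *+ a *+ j) (qexp r h j).

Let P_ge h mu j : fin mu <= W h j ->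
  trunc_ge v q (fin (mu - be *+ a *+ j)) (qexp r h j).
Proof.
move=> H; apply: trunc_ge_le (r_exact (size_qexp r1 h j)).
by rewrite fin_leB.
Qed.

Let P_size h mu j : (size (P h mu j) <= a)%N.
Proof.
apply/leq_sizeP => k ak; rewrite coef_gpoly // (qexp_small q1 _ ak) ?homp0 //.
by rewrite -ltnS -r_size size_qexp.
Qed.

(** The coefficient has degree below that of [r], so [nu] and the truncation at [q] agree on it, and
    its form in the given degree can vanish only if its value is larger. *)
Let P_eq0 h mu j : fin mu <= W h j -> (P h mu j == 0) = (W h j != fin mu).
Proof.
move=> H; rewrite -[RHS]andTb -{1}H -fin_lt_neq -fin_ltB.
have ge_x := P_ge H; have ex := r_exact (size_qexp r1 h j).
apply/eqP/idP => [z|lt]; last first.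
  apply/(gpoly_eq0 q1 q_be ge_x) => k; exact: lt_le_trans lt (ex k).
rewrite fin_lt_neq (trunc_ge_val q1 ge_x); apply/eqP => E.
by have := exact_gpoly q1 q_be ex E; rewrite -/(P h mu j) z eqxx.
Qed.

Lemma next_gpoly mu h : (forall j, fin mu <= W h j) ->
  trunc_ge v q (fin mu) h /\
  gpoly v q be mu h = \sum_(j < size h) P h mu j * rho ^+ j.
Proof.
move=> H; have M j : trunc_ge v q (fin mu) (qexp r h j * r ^+ j) /\
    gpoly v q be mu (qexp r h j * r ^+ j) = P h mu j * rho ^+ j.
  have [ge_r gr] := gpolyXn q1 q_be q_key j r_ge.
  have := gpolyM q1 q_be q_key (P_ge (H j)) ge_r.
  by rewrite subrK gr.
have [] := gpoly_sum q1 q_be (index_enum 'I_(size h)) (P := xpredT)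
  (F := fun j : 'I_(size h) => qexp r h j * r ^+ j) (b := mu) (fun j _ => (M j).1).
rewrite -(qexp_sum h r1) => ge_h ->; split=> //.
by apply: eq_bigr => j _; rewrite (M j).2.
Qed.

(** The forms [P h mu j] have degree below [a], so different powers of [rho] cannot cancel. In
    particular the minimum [mu] of [W] is also the truncation of [h] at [q]. *)
Lemma next_lead h : h != 0 -> exists mu J,
  [/\ forall j, fin mu <= W h j, W h J = fin mu,
      forall j, (J < j)%N -> fin mu < W h j &
      gpoly v q be mu h = \sum_(j < J.+1) P h mu j * rho ^+ j] /\
  size (gpoly v q be mu h) = (size (P h mu J) + a * J)%N.
Proof.
move=> h0; have [k hk] := qexp_neq0 r1 h0; have [c kc] := valp_fin v hk.
have Wk : W h k = fin (c + be *+ a *+ k) by rewrite /W kc.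
have [b [m [mb ble]]] := min_attained Wk (@W_big h).
have mh : (m < size h)%N by rewrite ltnNge; apply/negP => /W_big; rewrite mb.
pose J := \max_(j < size h | W h j == fin b) j.
have [J0 JW JE] : exists2 J0 : 'I_(size h), W h J0 == fin b & J = J0.
  have := eq_bigmax_cond (fun j : 'I_(size h) => j : nat)
    (A := [pred j : 'I_(size h) | W h j == fin b]).
  case; first by apply/card_gt0P; exists (Ordinal mh); rewrite inE /= mb.
  by move=> J0 J0W JE; exists J0.
have Jmax j : (J < j)%N -> fin b < W h j.
  move=> Jj; rewrite fin_lt_neq ble /=; apply: contraTN Jj => Wj.
  have jh : (j < size h)%N by rewrite ltnNge; apply/negP => /W_big E; rewrite E in Wj.
  by rewrite -leqNgt /J (leq_bigmax_cond (Ordinal jh)).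
have [_ gE] := next_gpoly ble.
have gE' : gpoly v q be b h = \sum_(j < J.+1) P h b j * rho ^+ j.
  have Jh : (J.+1 <= size h)%N by rewrite JE.
  pose F j := P h b j * rho ^+ j.
  rewrite gE -(big_mkord xpredT F) -[RHS](big_mkord xpredT F).
  rewrite (big_cat_nat (leq0n J.+1) Jh) /= [X in _ + X]big_nat_cond.
  rewrite [X in _ + X]big1 ?addr0 // => j /andP[/andP[Jj _] _].
  have := Jmax j Jj; rewrite fin_lt_neq => /andP[_].
  by rewrite -P_eq0 // /F => /eqP ->; rewrite mul0r.
exists b, J; split; first by split=> //; rewrite JE; apply/eqP.
rewrite gE'; apply: size_sum_monic_powers => //.
by rewrite P_eq0 // negbK JE.
Qed.

Lemma trunc_ge_next x h j : trunc_ge v q x h -> x <= W h j.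
Proof.
move=> ch; have [->|h0] := eqVneq h 0.
  by rewrite /W qexp0 valp0 inf_le_top.
(* An infinite [x] would force [nu h] to be infinite, against [h != 0]. *)
case: x ch => [c|] ch; last first.
  have [c hc] := valp_fin v h0.
  by have := trunc_ge_val q1 ch; rewrite hc.
have [mu [J [[ge_mu WJ _ _] sz]]] := next_lead h0.
apply: le_trans (ge_mu j); rewrite leNgt inf_ltE; apply/negP => lt.
have z := gpoly_lt q1 q_be lt ch; rewrite z size_poly0 in sz.
have : P h mu J == 0 by rewrite -size_poly_eq0; lia.
by rewrite P_eq0 // WJ eqxx.
Qed.

(** * Comparison of the degrees of the two initial forms *)

Section Jump.
Variables (h : {poly K}) (b b' : G) (n n' : nat).
Hypotheses (bh : trunc_ge v q (fin b) h) (b'h : trunc_ge v r (fin b') h).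
Hypotheses (nE : size (gpoly v q be b h) = n.+1).
Hypotheses (n'E : size (gpoly v r be' b' h) = n'.+1).

Let term_n' : term_value v r h n' = fin b'.
Proof.
apply: (gpoly_coef_neq0 r1 r_be' b'h).
have -> : n' = (size (gpoly v r be' b' h)).-1 by rewrite n'E.
by rewrite -lead_coefE lead_coef_eq0 -size_poly_eq0 n'E.
Qed.

Let h_lead : exists J,
  [/\ forall j, fin b <= W h j, W h J = fin b,
      forall j, (J < j)%N -> fin b < W h j &
      gpoly v q be b h = \sum_(j < J.+1) P h b j * rho ^+ j] /\
  n.+1 = (size (P h b J) + a * J)%N.
Proof.
have h0 : h != 0.
  by apply: contra_eq_neq nE => ->; rewrite gpoly0 // size_poly0.
have [mu [J [H sz]]] := next_lead h0.
have bE : b = mu.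
  have [le_mu WJ _ _] := H.
  apply: (gpoly_trunc_unique q1 q_be bh _ (next_gpoly le_mu).1).
    by rewrite -size_poly_eq0 nE.
  rewrite -size_poly_eq0 sz addn_eq0 size_poly_eq0 negb_and.
  by rewrite P_eq0 // negbK WJ eqxx.
by exists J; rewrite -nE bE sz.
Qed.

Lemma next_degree_le : (a * n' <= n)%N.
Proof.
have [J [[le_b WJ Wgt _] sz]] := h_lead.
suff n'J : (n' <= J)%N.
  have : P h b J != 0 by rewrite P_eq0 // negbK WJ eqxx.
  rewrite -size_poly_gt0 => P0; rewrite -ltnS sz.
  apply: leq_ltn_trans (_ : a * J < _)%N; first by rewrite leq_mul2l n'J orbT.
  by rewrite -[X in (X < _)%N]add0n ltn_add2r.
rewrite leqNgt; apply/negP => /[dup] /Wgt Wn' /ltnW Jn'.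
have := b'h J; rewrite -term_n' !term_W; apply/negP; rewrite -ltNge WJ.
apply: le_lt_trans (_ : _ <= fin b + fin (ep *+ n')) _.
  by rewrite inf_leD2lE ep_le.
by rewrite inf_ltD2rE.
Qed.

Hypotheses (a1 : a = 1%N) (nn' : n' = n).

Let P_const j : P h b j = (hom (b - be *+ a *+ j) (qexp r h j))%:P.
Proof.
rewrite /P -[qexp _ _ _ in LHS]mulr1 -(expr0 q) gpoly_mono //.
  by rewrite subr0 expr0 mulr1.
suff <- : size r = size q by rewrite size_qexp.
by rewrite r_size a1 muln1 prednK // ltnW.
Qed.

(** For [a = 1] the forms [P h b j] are constants, so [n] is the index [J] itself. A term [j < n]
    with minimal [W] would gain only [ep *+ j] and undercut, at [r], the [n]-th term, which is
    minimal there. *)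
Let h_lead_n : [/\ forall j, fin b <= W h j, W h n = fin b &
  gpoly v q be b h = P h b n * rho ^+ n].
Proof.
have [J [[le_b WJ Wgt gE] sz]] := h_lead.
have Jn : J = n.
  have P0 : P h b J != 0 by rewrite P_eq0 // negbK WJ eqxx.
  have : size (P h b J) = 1%N.
    by apply/eqP; rewrite eqn_leq -{1}a1 P_size size_poly_gt0.
  by rewrite a1 mul1n in sz; lia.
rewrite Jn in WJ gE; split=> //.
rewrite gE big_ord_recr big1 /= ?add0r // => j _.
suff /eqP -> : P h b j == 0 by rewrite mul0r.
rewrite P_eq0 //; apply/eqP => Wj.
have := b'h j; rewrite -term_n' nn' !term_W WJ Wj inf_leD2lE.
by apply/negP; rewrite -ltNge ep_lt.
Qed.

Lemma next_gpoly_power :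
  [/\ gpoly v q be b h = (inp v (qexp q h n))%:P * rho ^+ n,
      inp v (qexp q h n) = inp v (qexp r h n) &
      term_value v r h n = fin b'].
Proof.
have [le_b Wn gE] := h_lead_n.
have PE : P h b n = (inp v (qexp r h n))%:P.
  rewrite P_const; congr _%:P; apply: homp_inp.
  move: Wn; rewrite /W; case: (nu _) => // x; rewrite inf_addE => -[<-].
  by rewrite addrK.
have lead : (gpoly v q be b h)`_n = inp v (qexp q h n).
  apply: (coef_gpoly_inp q1 q_be); apply: (gpoly_coef_neq0 q1 q_be bh).
  have -> : n = (size (gpoly v q be b h)).-1 by rewrite nE.
  by rewrite -lead_coefE lead_coef_eq0 -size_poly_eq0 nE.
(* Both sides are the coefficient of degree [n] of the same form, as [rho ^+ n] is monic of degree
   [n]. *)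
have E : inp v (qexp q h n) = inp v (qexp r h n).
  rewrite -lead gE PE coefCM.
  have rn : rho ^+ n \is monic by apply: monic_exp.
  have sz : size (rho ^+ n) = n.+1.
    rewrite -(mul1r (_ ^+ _)) (size_mul_monic_exp _ rho_monic rho_size) ?oner_neq0 //.
    by rewrite size_poly1 a1 mul1n.
  by rewrite -[X in _`_X](erefl n.+1.-1) -sz -lead_coefE (monicP rn) mulr1.
by split=> //; rewrite ?gE ?PE ?E // -term_n' nn'.
Qed.

(* The terms of degree at most [n] of the [q]-expansion do not contribute to
   the [j]-th term of the [r]-expansion, as [q] and [r] have the same degree. *)
Lemma next_term_ge (x : withInf G) j : (n < j)%N ->
  (forall k, (n < k)%N -> x <= term_value v q h k) ->
  inf_sub x (fin b) <= inf_sub (term_value v r h j) (fin b').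
Proof.
move=> nj ch; have [_ Wn _] := h_lead_n.
have qr : size r = size q by rewrite r_size a1 muln1 prednK // ltnW.
pose e k := qexp q h k; pose A := \sum_(k < n.+1) e k * q ^+ k.
have A_j : qexp r A j = 0.
  rewrite qexp_addsum big1 // => k _; apply: (qexp_small r1 (a := k.+1)).
    rewrite qr mulnS; apply: leq_trans (size_polyMleq _ _) _.
    have sk : (size (q ^+ k)).-1 = ((size q).-1 * k)%N := size_exp q k.
    have := size_qexp q1 h k; rewrite -/(e k) -(prednK (ltnW q1)) ltnS => ek.
    rewrite -subn1 -addnBA; last by rewrite size_poly_gt0 expf_neq0 // -size_poly_gt0 ltnW.
    by rewrite subn1 sk leq_add2r.
  exact: leq_ltn_trans (leq_ord k) nj.
have cB : trunc_ge v q x (h - A).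
  move=> k; rewrite /term_value.
  have -> : qexp q (h - A) k = if (n < k)%N then qexp q h k else 0.
    have -> : qexp q (h - A) k = qexp q h k - qexp q A k.
      by apply/eqP; rewrite eq_sym subr_eq -qexpD subrK.
    rewrite (qexp_sumE q1) => [|i _]; last exact: size_qexp.
    by rewrite ltnS; case: leqP; rewrite ?subrr ?subr0.
  by case: ltnP => [/ch//|_]; rewrite valp0 inf_le_top.
have Wj : x <= W h j.
  have E : qexp r h j = qexp r (h - A) j.
    by rewrite -{1}(subrK A h) (qexpD r (h - A) A) A_j addr0.
  by rewrite /W E; apply: trunc_ge_next.
(* The truncation rises by [ep *+ n] from [q] to [r], while the [j]-th term gains [ep *+ j] over
   [W h j]. As [n < j], the gap cannot shrink. *)
have b'E : fin b' = fin b + fin (ep *+ n) by rewrite -term_n' term_W nn' Wn.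
rewrite term_W; case: (W h j) Wj => [w|]; last by move=> _; apply: inf_le_top.
case: x {ch cB} => [c|] // cw.
move: b'E; rewrite !inf_addE => -[->] /=; rewrite inf_leE -inf_leE.
have -> : w + ep *+ j - (b + ep *+ n) = w + (ep *+ j - ep *+ n) - b.
  by rewrite opprD [- b + _]addrC !addrA.
rewrite fin_leB inf_addE subrK -inf_addE -[fin c]addr0; apply: inf_leD2 => //.
rewrite -[0]/(fin 0) -(inf_leD2rE (ep *+ n)) !inf_addE subrK add0r.
exact: ep_le (ltnW nj).
Qed.

End Jump.

End NextKey.

(** * Standard exponents *)

Section Indices.
Context {d : Order.disp_t} {L : bOrderType d}.
Variable alpha : L -> nat.
Implicit Types (i j k l m q : L).

Lemma lt_succ_le i j k : is_succ i j -> (k < j)%O -> (k <= i)%O.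
Proof.
move=> [_ H] kj; rewrite leNgt; apply/negP => /H.
by rewrite leNgt kj.
Qed.

Lemma succ_inj i j k : is_succ i j -> is_succ i k -> j = k.
Proof.
move=> [ij Hj] [ik Hk]; apply/le_anti/andP; split; [exact: Hj | exact: Hk].
Qed.

Lemma succ_predI i j k : is_succ i k -> is_succ j k -> i = j.
Proof.
move=> ik jk; apply/le_anti/andP; split.
  exact: lt_succ_le jk ik.1.
exact: lt_succ_le ik jk.1.
Qed.

Lemma is_add_le i t k : is_add i t k -> (i <= k)%O.
Proof.
elim: t k => [|t IH] k /=; first by move=> ->.
by case=> j [/IH ij [jk _]]; apply: le_trans ij (ltW jk).
Qed.

Lemma is_add_inj i t j k : is_add i t j -> is_add i t k -> j = k.
Proof.
elim: t j k => [|t IH] j k /=; first by move=> -> ->.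
by move=> [x [ix xj]] [y [iy]]; rewrite -(IH _ _ ix iy); apply: succ_inj.
Qed.

Lemma is_add_addn i s t j k : is_add i s j -> is_add j t k -> is_add i (s + t) k.
Proof.
elim: t k => [|t IH] k ij /=; first by move=> ->; rewrite addn0.
by move=> [x [jx xk]]; rewrite addnS /=; exists x; split=> //; apply: IH.
Qed.

Lemma is_add_split i s t k : is_add i (s + t) k ->
  exists j, is_add i s j /\ is_add j t k.
Proof.
elim: t k => [|t IH] k; first by rewrite addn0; exists k.
by rewrite addnS => -[x [/IH[j [ij jx]] xk]]; exists j; split=> //; exists x.
Qed.

Lemma is_add_between i t k m : is_add i t k -> (i <= m)%O -> (m <= k)%O ->
  exists s, is_add i s m.
Proof.
elim: t k => [|t IH] k /=.
  by move=> -> im mi; exists 0%N => /=; apply/le_anti; rewrite mi im.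
move=> [x [ix xk]] im; rewrite le_eqVlt => /orP[/eqP ->|/(lt_succ_le xk)].
  by exists t.+1, x.
exact: IH.
Qed.

Lemma omega_lt i l : is_add_omega i l -> (i < l)%O.
Proof. by move=> [/(_ 0%N)[k [-> //]]]. Qed.

(** Otherwise [is_add_between] puts every [i + t] below [m], and then the supremum [l] is at most
    [m]. *)
Lemma omega_between i l m : is_add_omega i l -> (i <= m)%O -> (m < l)%O ->
  exists t, is_add i t m.
Proof.
move=> [_ H] im ml; apply: NNPP => N.
suff : (l <= m)%O by rewrite leNgt ml.
apply: H => t k ik; rewrite ltNge; apply/negP => mk.
by apply: N; apply: is_add_between ik im mk.
Qed.

Lemma omega_unshift i t m l : is_add i t m -> is_add_omega m l -> is_add_omega i l.
Proof.
move=> im [H1 H2]; split=> [s|l0 Hl0].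
  have [k [mk kl]] := H1 s.
  have := is_add_addn im mk; rewrite addnC => /is_add_split[j [ij jk]].
  by exists j; split=> //; apply: le_lt_trans (is_add_le jk) kl.
by apply: H2 => s k mk; apply: Hl0 (is_add_addn im mk).
Qed.

Lemma omega_shift i l m : is_add_omega i l -> (i <= m)%O -> (m < l)%O ->
  is_add_omega m l.
Proof.
move=> il im ml; have [t imt] := omega_between il im ml.
split=> [s|l0 Hl0].
  have [k [ik kl]] := il.1 (t + s)%N; have [j [ij jk]] := is_add_split ik.
  by exists k; rewrite (is_add_inj imt ij).
apply: il.2 => s k ik; case: (ltP k m) => [km|mk].
  by apply: lt_trans km _; apply: Hl0 (_ : is_add m 0 m).
have [k' [ik' k'l]] := il.1 s; have kk' := is_add_inj ik ik'.
have : exists u, is_add m u k.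
  have [kt [ikt _]] := il.1 (t + s)%N; have [x [ix xk]] := is_add_split ikt.
  rewrite addnC in ikt; have [y [iy yk]] := is_add_split ikt.
  rewrite -(is_add_inj imt ix) in xk; rewrite -(is_add_inj ik iy) in yk.
  exact: is_add_between xk mk (is_add_le yk).
by case=> u; apply: Hl0.
Qed.

Lemma omega_inj i j k : is_add_omega i j -> is_add_omega i k -> j = k.
Proof.
move=> [j1 j2] [k1 k2]; apply/le_anti/andP; split.
  by apply: j2 => t x ix; have [y [/(is_add_inj ix) <-]] := k1 t.
by apply: k2 => t x ix; have [y [/(is_add_inj ix) <-]] := j1 t.
Qed.

Lemma omega_not_succ i l m : is_add_omega i l -> ~ is_succ m l.
Proof.
move=> il ml; have im := lt_succ_le ml (omega_lt il).
have [t imt] := omega_between il im ml.1.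
have [k [[x [/(is_add_inj imt) <- mk]] kl]] := il.1 t.+1.
by move: kl; rewrite (succ_inj mk ml) ltxx.
Qed.

(* [i+ = j] in the index set {q | q <= j}: an inessential [i] with successor
   [j] is not inessential there, since [i + omega] lies outside. *)
Definition plus_pred i j : Prop :=
  is_succ i j \/ (inessential alpha (@whole d L) i /\ is_add_omega i j).

Lemma is_plus_lt U i j : is_plus alpha U i j -> (i < j)%O.
Proof. by case=> _ [[_ /omega_lt]|[_ []]]. Qed.

Lemma upto_inessential l m q : (m <= l)%O ->
  inessential alpha (upto m) q -> inessential alpha (upto l) q.
Proof. by move=> ml [[j jm qj] a]; split=> //; exists j => //; apply: le_trans jm ml. Qed.

Lemma inessential_shift U i l m : inessential alpha U i -> is_add_omega i l ->
  (i <= m)%O -> (m < l)%O -> inessential alpha U m.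
Proof.
move=> [[j jU ij] a] il im ml; have [t imt] := omega_between il im ml.
split; last by move=> s k mk; apply: a (is_add_addn imt mk).
by exists j => //; rewrite -(omega_inj il ij); apply: omega_shift il im ml.
Qed.

Lemma inessential_unshift U t i m : inessential alpha U i -> is_add i t m ->
  alpha m = 1%N.
Proof. by move=> [_ a]; apply: a. Qed.

Lemma inessential_upto_omega l q : inessential alpha (@whole d L) q ->
  is_add_omega q l -> inessential alpha (upto l) q.
Proof. by move=> [_ a] ql; split=> //; exists l => //; apply: lexx. Qed.

Lemma inessential_upto_eq l m q j : (j <= m)%O -> is_add_omega q j ->
  inessential alpha (upto l) q -> inessential alpha (upto m) q.
Proof. by move=> jm qj [_ a]; split=> //; exists j. Qed.

Local Notation expo := {fsfun L -> nat with 0%N}.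
Implicit Type g : expo.
Hypothesis alpha_gt0 : forall i, (0 < alpha i)%N.

Section Successor.
Variables m l : L.
Hypothesis ml : is_succ m l.

(** A successor is never of the form [q + omega]. So the same indices are inessential up to [l] and
    up to [m], and the two meanings of [+] differ at [m] only. *)
Let omega_le q j : is_add_omega q j -> (j <= l)%O -> (j <= m)%O.
Proof.
move=> qj; rewrite le_eqVlt => /orP[/eqP E|/(lt_succ_le ml)//].
by rewrite E in qj; case: (omega_not_succ qj ml).
Qed.

Let iness q : inessential alpha (upto l) q -> inessential alpha (upto m) q.
Proof. by move=> [[j jl qj] a]; split=> //; exists j => //; apply: omega_le qj jl. Qed.

Let plus_up q q' : is_plus alpha (upto m) q q' -> is_plus alpha (upto l) q q'.
Proof.
move=> [q'm H]; split; first exact: le_trans q'm (ltW ml.1).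
case: H => [[I O]|[I S]]; [left|right]; split=> //.
  exact: upto_inessential (ltW ml.1) I.
by move/iness.
Qed.

Let plus_down q q' : (q < m)%O -> is_plus alpha (upto l) q q' ->
  is_plus alpha (upto m) q q'.
Proof.
move=> qm [q'l H]; case: H => [[I O]|[I S]].
  by split; [apply: omega_le O q'l | left; split=> //; apply: iness].
split; first by apply: S.2.
by right; split=> //; apply: contra_not I; apply: upto_inessential (ltW ml.1).
Qed.

Let plus_m : is_plus alpha (upto l) m l.
Proof.
split; first exact: lexx.
right; split=> // -[[j jl mj] _].
by have := omega_lt mj; rewrite ltNge (omega_le mj jl).
Qed.

Lemma split_standard_succ g : free_standard alpha l g ->
  (g m < alpha l)%N /\ free_standard alpha m [fsfun g with m |-> 0%N].
Proof.
move=> [[c1 c2 c3] gl]; split; first exact: c2 ml.1 plus_m.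
have g'E q : [fsfun g with m |-> 0%N] q <> 0%N -> (q <> m) /\ g q <> 0%N.
  by rewrite fsfun_withE; case: eqP.
split; last by rewrite fsfun_with.
split.
- move=> q /g'E[qm gq]; have := c1 q gq; rewrite le_eqVlt => /orP[/eqP E|].
    by rewrite E in gq.
  exact: lt_succ_le.
- move=> q q' qm /plus_up qq'; rewrite fsfun_withE; case: eqP => // _.
  by apply: c2 qq'; apply: lt_trans qm ml.1.
- move=> i i' j k /(upto_inessential (ltW ml.1)) I /plus_up pi /plus_up pj /plus_up pk.
  by move=> /g'E[_ gj] /g'E[_ gk]; apply: c3 I pi pj pk gj gk.
Qed.

Lemma glue_standard_succ g n : free_standard alpha m g -> (n < alpha l)%N ->
  free_standard alpha l [fsfun g with m |-> n].
Proof.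
move=> [[c1 c2 c3] gm] nl.
have gl0 q : (m < q)%O -> g q = 0%N.
  by move=> mq; apply: NNPP => /c1; rewrite leNgt mq.
have neq q : (q < m)%O -> (q == m) = false by move=> qm; rewrite lt_eqF.
split; last first.
  rewrite fsfun_withE; case: eqP => [E|_]; last exact: gl0 ml.1.
  by have := ml.1; rewrite E ltxx.
split.
- move=> q; rewrite fsfun_withE; case: eqP => [-> _|_ /c1 qm].
    exact: ltW ml.1.
  exact: le_trans qm (ltW ml.1).
- move=> q q' ql qq'; rewrite fsfun_withE; case: eqP => [E|qm].
    rewrite E in qq'; case: qq' => q'l [[I O]|[_ S]].
      by have := omega_lt O; rewrite ltNge (omega_le O q'l).
    by rewrite (succ_inj S ml).
  have {}qm : (q < m)%O by rewrite lt_neqAle (lt_succ_le ml ql) andbT; apply/eqP.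
  exact: c2 qm (plus_down qm qq').
- move=> i i' j k I pi pj pk.
  have O : is_add_omega i i' by case: pi => _ [[]|[]].
  have i'm : (i' <= m)%O by apply: omega_le O pi.1.
  have jm := lt_le_trans (is_plus_lt pj) i'm.
  have km := lt_le_trans (is_plus_lt pk) i'm.
  rewrite !fsfun_withE !neq //.
  apply: c3 (iness I) (plus_down _ pi) (plus_down jm pj) (plus_down km pk).
  exact: lt_le_trans (is_plus_lt pi) i'm.
Qed.

End Successor.

Section Limit.
Variable l : L.

Let plus_l q := inessential alpha (@whole d L) q /\ is_add_omega q l.

Let plus_lP q : plus_l q -> is_plus alpha (upto l) q l.
Proof.
move=> [I O]; split; first exact: lexx.
by left; split=> //; apply: inessential_upto_omega.
Qed.

(** The third condition of [standard] lets at most one [q] with [q+ = l] carry a nonzero exponent;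
    [m] is that index, or [i0] if there is none. *)
Lemma split_standard_limit i0 g : plus_l i0 -> free_standard alpha l g ->
  exists m, [/\ plus_l m, (g m < alpha l)%N &
    free_standard alpha m [fsfun g with m |-> 0%N]].
Proof.
move=> pi0 [[c1 c2 c3] gl].
have [m [pm gm]] : exists m, plus_l m /\ forall q, plus_l q -> q <> m -> g q = 0%N.
  have [[m [pm gm]]|N] := classic (exists m, plus_l m /\ g m <> 0%N).
    exists m; split=> // q pq qm; apply: NNPP => gq; apply: qm.
    have I := inessential_upto_omega pm.1 pm.2.
    exact: c3 I (plus_lP pm) (plus_lP pq) (plus_lP pm) gq gm.
  exists i0; split=> // q pq _; apply: NNPP => gq; apply: N.
  by exists q.
have [Im Om] := pm; have ml := omega_lt Om.
exists m; split=> //; first by apply: c2 ml (plus_lP pm).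
have g'E q : [fsfun g with m |-> 0%N] q <> 0%N -> (q <> m) /\ g q <> 0%N.
  by rewrite fsfun_withE; case: eqP.
split; last by rewrite fsfun_with.
split.
- move=> q /g'E[qm gq]; rewrite leNgt; apply/negP => mq; case: (gq).
  have ql : (q < l)%O.
    by rewrite lt_neqAle (c1 q gq) andbT; apply/eqP => E; rewrite E in gq.
  apply: gm qm; split; last exact: omega_shift Om (ltW mq) ql.
  exact: inessential_shift Im Om (ltW mq) ql.
- move=> q q' qm [q'm H]; rewrite fsfun_withE; case: eqP => // qm'.
  have [/gm -> //|npq] := classic (plus_l q).
  have ql : (q < l)%O by apply: lt_trans qm ml.
  apply: (c2 _ _ ql); split; first exact: le_trans q'm (ltW ml).
  case: H => [[I O]|[NI S]]; [left|right]; split=> //.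
    exact: upto_inessential (ltW ml) I.
  (* If [q] is inessential up to [l] but not up to [m], then [q + omega] lies past [m]. So [m] is
     some [q + t], whence [q + omega = l], contrary to [npq]. *)
  move=> I; have [[j jl qj] a] := I.
  case: (leP j m) => [jm|mj]; first by apply: NI; apply: inessential_upto_eq jm qj I.
  have [t qmt] := omega_between qj (ltW qm) mj.
  apply: npq; split; last exact: omega_unshift qmt Om.
  by split=> //; exists j.
- move=> i i' j k I pi pj pk /g'E[_ gj] /g'E[_ gk].
  have O : is_add_omega i i' by case: pi => _ [[]|[]].
  have up q : is_plus alpha (upto m) q i' -> is_plus alpha (upto l) q i'.
    move=> [i'm [[Iq Oq]|[_ S]]]; last by case: (omega_not_succ O S).
    split; first exact: le_trans i'm (ltW ml).
    by left; split=> //; apply: upto_inessential (ltW ml) Iq.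
  exact: c3 (upto_inessential (ltW ml) I) (up _ pi) (up _ pj) (up _ pk) gj gk.
Qed.

Lemma glue_standard_limit m g n : plus_l m -> free_standard alpha m g ->
  (n < alpha l)%N -> free_standard alpha l [fsfun g with m |-> n].
Proof.
move=> pm [[c1 c2 c3] gm] nl; have [Im Om] := pm; have ml := omega_lt Om.
have g_gt q : (m < q)%O -> g q = 0%N.
  by move=> mq; apply: NNPP => /c1; rewrite leNgt mq.
(* Up to [m] such a [q] is no longer inessential, so its [+] is its successor, where [alpha] is 1,
   and standardness reads [g q < 1]. This keeps [m] the only index of its run with a nonzero
   exponent after gluing. *)
have g0 q q' : (q < m)%O -> inessential alpha (upto l) q -> is_add_omega q q' ->
    (m < q')%O -> g q = 0%N.
  move=> qm I O mq'; have [k [[x [/= -> qk]] kq']] := O.1 1%N.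
  have := c2 q k qm; rewrite (inessential_unshift (t := 1%N) I); last by exists q.
  case: (g q) => // y H; suff : (y.+1 < 1)%N by [].
  apply: H; split; first exact: qk.2.
  right; split=> // -[[j jm qj] _].
  by move: jm; rewrite /upto leNgt (omega_inj qj O) mq'.
split; last first.
  by rewrite fsfun_withE (gt_eqF ml); apply: g_gt.
split.
- move=> q; rewrite fsfun_withE; case: eqP => [-> _|_ /c1 qm].
    exact: ltW ml.
  exact: le_trans qm (ltW ml).
- move=> q q' ql [q'l H]; rewrite fsfun_withE; case: eqP => [E|/eqP qm].
    rewrite E in H; case: H => [[I O]|[NI S]]; first by rewrite (omega_inj O Om).
    by case: NI; apply: inessential_upto_omega.
  case: (ltP m q) => [/g_gt ->//|qm']; have {}qm : (q < m)%O by rewrite lt_neqAle qm.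
  case: H => [[I O]|[NI S]].
    case: (leP q' m) => [q'm|/(g0 q q' qm I O) -> //].
    apply: (c2 _ _ qm); split=> //; left; split=> //.
    exact: inessential_upto_eq q'm O I.
  apply: (c2 _ _ qm); split; first exact: S.2.
  by right; split=> //; apply: contra_not NI; apply: upto_inessential (ltW ml).
- move=> i i' j k I pi pj pk.
  have O : is_add_omega i i' by case: pi => _ [[]|[]].
  have lim q : is_plus alpha (upto l) q i' ->
      inessential alpha (upto l) q /\ is_add_omega q i'.
    by move=> [_ [//|[_ S]]]; case: (omega_not_succ O S).
  have [Ij Oj] := lim j pj; have [Ik Ok] := lim k pk.
  case: (leP i' m) => [i'm|mi'].
    have neq q : is_plus alpha (upto l) q i' -> (q == m) = false.
      by move=> pq; rewrite lt_eqF // (lt_le_trans (is_plus_lt pq)).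
    have down q : inessential alpha (upto l) q -> is_add_omega q i' ->
        is_plus alpha (upto m) q i'.
      by move=> Iq Oq; split=> //; left; split=> //; apply: inessential_upto_eq i'm Oq Iq.
    rewrite !fsfun_withE !neq //.
    exact: c3 (inessential_upto_eq i'm O I) (down i I O) (down j Ij Oj) (down k Ik Ok).
  have eqm q : inessential alpha (upto l) q -> is_add_omega q i' ->
      [fsfun g with m |-> n] q <> 0%N -> q = m.
    move=> Iq Oq; rewrite fsfun_withE; case: eqP => // qm; case: (ltP m q) => [/g_gt ->//|].
    by rewrite le_eqVlt => /orP[/eqP //|qm']; rewrite (g0 q i').
  by move=> /(eqm j Ij Oj) -> /(eqm k Ik Ok) ->.
Qed.

End Limit.

(** Turns standardness, a condition on all exponents at once, into a recursion on the last index
    involved. Degree counts use it directly, the construction of expansions uses its converse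
    [glue_standard]. *)
Lemma split_standard l g : (exists m, plus_pred m l) -> free_standard alpha l g ->
  exists m, [/\ plus_pred m l, (g m < alpha l)%N &
    free_standard alpha m [fsfun g with m |-> 0%N]].
Proof.
move=> [m [S|P]] gs.
  by exists m; have [? ?] := split_standard_succ S gs; split=> //; left.
by have [k [? ? ?]] := split_standard_limit P gs; exists k; split=> //; right.
Qed.

Lemma glue_standard l m g n : plus_pred m l -> free_standard alpha m g ->
  (n < alpha l)%N -> free_standard alpha l [fsfun g with m |-> n].
Proof. by case=> [S|P]; [apply: glue_standard_succ | apply: glue_standard_limit]. Qed.

Lemma free_standard_bot g : free_standard alpha \bot%O g -> g =1 (fun=> 0%N).
Proof.
move=> [[c1 _ _] g0] q; apply: NNPP => /[dup] /c1.
by rewrite le_eqVlt ltx0 orbF => /eqP ->.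
Qed.

Lemma is_plus_whole_limit l m : (forall k, ~ is_succ k l) ->
  is_plus alpha (@whole d L) m l -> inessential alpha (@whole d L) m /\ is_add_omega m l.
Proof. by move=> nS [_ [//|[_ /nS]]]. Qed.

End Indices.

(** * Initial forms of standard expansions *)

Section SubringGen.
Variables (R : nzRingType) (S : R -> Prop).
Local Notation A := (subring_gen S).

Lemma subring_gen0 : A 0.
Proof. by rewrite -(subrr 1); apply: subring_genB; apply: subring_gen_1. Qed.

Lemma subring_genD x y : A x -> A y -> A (x + y).
Proof.
move=> Ax Ay; rewrite -[y]opprK; apply: subring_genB => //.
by rewrite -(sub0r y); apply: subring_genB => //; apply: subring_gen0.
Qed.

Lemma subring_genX x n : A x -> A (x ^+ n).
Proof.
move=> Ax; elim: n => [|n IH]; first by rewrite expr0; apply: subring_gen_1.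
by rewrite exprS; apply: subring_genM.
Qed.

End SubringGen.

Section Monomials.
Local Open Scope fset_scope.
Local Open Scope ring_scope.
Context {K : fieldType} {G : oagType}.
Variable v : valuation {fraction {poly K}} G.
Context {d : Order.disp_t} {L : bOrderType d}.
Variables (alpha : L -> nat) (Q : L -> {poly K}).
Implicit Types (i l : L) (f p q : {poly K}) (b : G).
Local Notation nu := (valp v).
Local Notation hom b f := (homclass v b (FracField.tofrac f)).
Local Notation expo := {fsfun L -> nat with 0%N}.
Implicit Type g : expo.
Local Notation mono := (K * expo)%type.
Implicit Type s : seq mono.

Lemma Qprod_wide (A : {fset L}) g : finsupp g `<=` A ->
  Qprod Q g = \prod_(i <- A) Q i ^+ g i.
Proof.
move=> gA; apply: big_fset_incl => // i _ iN.
by rewrite fsfun_dflt.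
Qed.

Lemma Qprod_with g m n : g m = 0%N ->
  Qprod Q [fsfun g with m |-> n] = Qprod Q g * Q m ^+ n.
Proof.
move=> gm; pose A := m |` finsupp g.
have gA : finsupp g `<=` A by apply: fsubsetUr.
have g'A : finsupp [fsfun g with m |-> n] `<=` A.
  rewrite finsupp_with; case: eqP => _; last by [].
  by apply: fsubset_trans gA; apply: fsubD1set.
rewrite (Qprod_wide gA) (Qprod_wide g'A).
have mA : m \in A by rewrite in_fset1U eqxx.
rewrite [LHS](big_fsetD1 m mA) [X in _ = X * _](big_fsetD1 m mA) /=.
rewrite fsfun_with gm expr0 mul1r mulrC; congr (_ * _).
apply: eq_big_seq => i; rewrite in_fsetD1 => /andP[/negbTE im _].
by rewrite fsfun_withE im.
Qed.

Lemma Qprod_split g m :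
  Qprod Q g = Qprod Q [fsfun g with m |-> 0%N] * Q m ^+ g m.
Proof.
rewrite -Qprod_with ?fsfun_with //; congr (Qprod Q _).
apply/fsfunP => i; rewrite !fsfun_withE; case: eqP => [->//|//].
Qed.

Lemma inp1 : inp v (1 : {poly K}) = 1.
Proof. by rewrite -(homp_inp (valp1 v)) rmorph1 homclass1. Qed.

Lemma inpM p q : inp v (p * q) = inp v p * inp v q.
Proof. by rewrite /inp rmorphM initM. Qed.

Lemma inpX p n : inp v (p ^+ n) = inp v p ^+ n.
Proof.
by elim: n => [|n IH]; rewrite ?expr0 ?inp1 // !exprS inpM IH.
Qed.

Lemma size_sum_monom n s :
  (forall m, m \in s -> (size (Qprod Q m.2) <= n)%N) -> (size (sum_monom Q s) <= n)%N.
Proof.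
move=> H; rewrite /sum_monom big_seq; apply: leq_trans (size_sum _ _ _) _.
apply/bigmax_leqP_seq => m ms _; rewrite /monom mul_polyC.
by apply: leq_trans (size_scale_leq _ _) (H m ms).
Qed.

Lemma init_alg_Qprod l g : (forall i, g i <> 0%N -> (i < l)%O) ->
  init_alg Q l (inp v (Qprod Q g)).
Proof.
move=> gl; rewrite /Qprod; apply: (big_ind (fun p => init_alg Q l (inp v p))).
- by rewrite inp1; apply: subring_gen_1.
- by move=> x y; rewrite inpM; apply: subring_genM.
move=> i _; rewrite inpX; case: (eqVneq (g i) 0%N) => [->|/eqP gi].
  by rewrite expr0; apply: subring_gen_1.
apply: subring_genX; apply: subring_gen_in; right.
by exists i => //; apply: gl.
Qed.

Lemma init_alg_monom l (m : mono) : free_standard alpha l m.2 ->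
  init_alg Q l (inp v (monom Q m)).
Proof.
move=> [[c1 _ _] ml]; rewrite /monom inpM; apply: subring_genM.
  by apply: subring_gen_in; left; exists m.1.
apply: init_alg_Qprod => i gi; rewrite lt_neqAle (c1 i gi) andbT.
by apply/eqP => E; rewrite E in gi.
Qed.

Lemma free_expansion_le l s m : free_expansion v alpha Q l s -> m \in s ->
  nu (sum_monom Q s) <= nu (monom Q m).
Proof.
by move=> [_ _ ->] ms; apply: ge_bigmin_seq ms _.
Qed.

Lemma homp_sum_monom b s : (forall m, m \in s -> fin b <= nu (monom Q m)) ->
  hom b (sum_monom Q s) = \sum_(m <- s) hom b (monom Q m).
Proof.
move=> H; rewrite /sum_monom big_seq [RHS]big_seq raddf_sum; exact: homclass_sum.
Qed.

(** The value of the expansion is the least value of its monomials, so none lies below degree [b].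
    Those of value [b] contribute products of initial forms, the others vanish in this degree. *)
Lemma init_alg_hom l b p : is_free_expansion v alpha Q l p -> fin b <= nu p ->
  init_alg Q l (hom b p).
Proof.
move=> [s ss ->] bp; have bm m (ms : m \in s) := le_trans bp (free_expansion_le ss ms).
rewrite (homp_sum_monom bm) big_seq.
apply: (big_ind (init_alg Q l)).
- exact: subring_gen0.
- by move=> x y; apply: subring_genD.
move=> m ms; have := bm m ms; rewrite le_eqVlt => /orP[/eqP E|lt].
  by rewrite homp_inp //; apply: init_alg_monom; case: ss => _ H _; apply: H.
by rewrite homclass_gt //; apply: subring_gen0.
Qed.

Lemma valp_sum_monom_ge x s : (forall m, m \in s -> x <= nu (monom Q m)) ->
  x <= nu (sum_monom Q s).
Proof. by move=> H; rewrite /sum_monom big_seq; apply: valp_sum. Qed.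

End Monomials.

(** * Transfinite induction on key polynomials *)

Section KeyInduction.
Context {K : fieldType} {G : oagType}.
Variable v : valuation {fraction {poly K}} G.
Context {d : Order.disp_t} {L : bOrderType d}.
Variables (alpha : L -> nat) (Q : L -> {poly K}).
Hypothesis key : key_polynomials v alpha Q.
Implicit Types (i l m : L) (f p q : {poly K}) (b : G).
Local Notation nu := (valp v).
Local Notation hom b f := (homclass v b (FracField.tofrac f)).
Local Notation expo := {fsfun L -> nat with 0%N}.
Implicit Type g : expo.
Local Notation mono := (K * expo)%type.

(** The invariant of the induction. Its two middle clauses identify free [l]-standard expansions
    with polynomials of degree below [Q l]. This puts the coefficients of [gpoly] into [init_alg]
    and makes any [l]-standard expansion the [Q l]-expansion. *)
Definition regular l : Prop :=
  [/\ (1 < size (Q l))%N,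
      forall g, free_standard alpha l g -> (size (Qprod Q g) < size (Q l))%N,
      forall f, (size f < size (Q l))%N -> is_free_expansion v alpha Q l f &
      is_key v (Q l)].

Lemma key_monic l : Q l \is monic. Proof. exact: pk_monic (kp_pre key) l. Qed.

Lemma key_neq0 l : Q l != 0. Proof. exact: monic_neq0 (key_monic l). Qed.

Lemma key_alpha_gt0 l : (0 < alpha l)%N. Proof. exact: pk_alpha_gt0 (kp_pre key) l. Qed.

Lemma free_expansion_size l p : regular l ->
  is_free_expansion v alpha Q l p -> (size p < size (Q l))%N.
Proof.
move=> [l1 F1 _ _] [s [_ fs _] ->].
rewrite -(prednK (ltnW l1)) ltnS; apply: size_sum_monom => e /fs /F1.
by move=> H; rewrite -ltnS (prednK (ltnW l1)).
Qed.

(** Expand the coefficients at [Q m] and multiply their monomials by powers of [Q m]. Exactness of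
    [f] at [Q m] ensures that no monomial obtained has value below [nu f]. *)
Lemma glue_expansion m l f : plus_pred alpha m l -> regular m ->
  size (Q l) = ((size (Q m)).-1 * alpha l).+1 -> exact v (Q m) f ->
  (size f < size (Q l))%N -> is_free_expansion v alpha Q l f.
Proof.
move=> ml [m1 F1 F2 _] szl ef fl.
pose S j := proj1_sig (constructive_indefinite_description _
  (let: ex_intro2 s A B := F2 _ (size_qexp m1 f j) in
   ex_intro (fun s => free_expansion v alpha Q m s /\ qexp (Q m) f j = sum_monom Q s)
     s (conj A B))).
have SP j : free_expansion v alpha Q m (S j) /\ qexp (Q m) f j = sum_monom Q (S j).
  by rewrite /S; case: constructive_indefinite_description.
pose lift j (e : mono) : mono := (e.1, [fsfun e.2 with m |-> j]).
pose s := [seq lift j e | j <- iota 0 (alpha l), e <- S j].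
have liftE j e : e \in S j -> monom Q (lift j e) = monom Q e * Q m ^+ j.
  move=> es; rewrite /monom /= Qprod_with ?mulrA //.
  by have [[_ /(_ e es)[]]] := SP j.
have fE : f = sum_monom Q s.
  rewrite /sum_monom /s big_allpairs_dep -(subn0 (alpha l)) big_mkord.
  have fl0 j : (alpha l <= j)%N -> qexp (Q m) f j = 0.
    by apply: qexp_small => //; rewrite -ltnS -szl.
  rewrite {1}(qexp_sum_wide m1 fl0); apply: eq_bigr => j _.
  rewrite (SP j).2 /sum_monom mulr_suml; apply: eq_big_seq => e es.
  by rewrite liftE.
exists s => //; split.
- have -> : unzip2 s =
      [seq [fsfun g with m |-> j] | j <- iota 0 (alpha l), g <- unzip2 (S j)].
    rewrite /s /unzip2 map_allpairs; congr flatten; apply: eq_map => j.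
    by rewrite -map_comp.
  have g0 j g : g \in unzip2 (S j) -> g m = 0%N.
    by case/mapP => e es ->; have [[_ /(_ e es)[]]] := SP j.
  apply: allpairs_uniq_dep; first exact: iota_uniq.
    by move=> j _; have [[]] := SP j.
  (* The exponent at [m] recovers [j], and setting it back to 0 recovers the free exponent. *)
  move=> _ _ /allpairsPdep[j [g [_ gs ->]]] /allpairsPdep[j' [g' [_ gs' ->]]] /= E.
  have jj' : j = j' by have /fsfunP/(_ m) := E; rewrite !fsfun_with.
  rewrite jj' in gs E *; congr Tagged; apply/fsfunP => q.
  have /fsfunP/(_ q) := E; rewrite !fsfun_withE; case: eqP => [-> _|//].
  by rewrite (g0 _ _ gs) (g0 _ _ gs').
- move=> _ /allpairsPdep[j [e [ja es ->]]] /=.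
  apply: glue_standard => //; first exact: key_alpha_gt0.
    by have [[_ /(_ e es)]] := SP j.
  by rewrite mem_iota in ja.
apply/le_anti/andP; split; last first.
  by apply: valp_sum_monom_ge => e es; apply: ge_bigmin_seq es _.
rewrite big_seq; apply: le_bigmin => [|_ /allpairsPdep[j [e [_ es ->]]]].
  exact: inf_le_top.
rewrite -fE liftE // valpM valpX; apply: le_trans (ef j) _.
rewrite /term_value addrC [leRHS]addrC; apply: inf_leD.
by rewrite (SP j).2; apply: free_expansion_le es; apply: (SP j).1.
Qed.

(** * The successor step *)

Section SuccessorKey.
Variables m l : L.
Hypotheses (ml : is_succ m l) (m_reg : regular m).
Variable be : G.
Hypothesis m_be : nu (Q m) = fin be.
Local Notation a := (alpha l).
Local Notation rho := (gpoly v (Q m) be (be *+ a) (Q l)).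

Let m1 : (1 < size (Q m))%N. Proof. by case: m_reg. Qed.

(** The coefficients of the given standard expansion have degree below [Q m], so by uniqueness it is
    the [Q m]-expansion of [Q l]. Reading it coefficientwise in degree [be *+ a] yields the
    prescribed relation. *)
Let relation : exists s : nat -> seq mono,
  [/\ forall j, (j < a)%N -> fin (be *+ a - be *+ j) <= nu (sum_monom Q (s j)),
      size (Q l) = ((size (Q m)).-1 * a).+1,
      forall j, qexp (Q m) (Q l) j =
        if (j < a)%N then sum_monom Q (s j) else (j == a)%:R,
      rho = relation_poly v Q m a s &
      minimal_relation (star (init_alg Q m)) (inp v (Q m)) (relation_poly v Q m a s)].
Proof.
have [s [se QE sv mr]] := kp_successor key ml; exists s.
pose e j := if (j < a)%N then sum_monom Q (s j) else (j == a)%:R.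
have e_size j : (size (e j) < size (Q m))%N.
  rewrite /e; case: ifP => [ja|_].
    by apply: free_expansion_size => //; exists (s j) => //; apply: se.
  by case: eqP => _; rewrite ?size_poly1 // size_poly0 ltnW.
have QE' : Q l = \sum_(j < a.+1) e j * Q m ^+ j.
  rewrite big_ord_recr /= /e ltnn eqxx mul1r addrC QE; congr (_ + _).
  by apply: eq_bigr => j _; rewrite ltn_ord.
have cE j : qexp (Q m) (Q l) j = e j.
  rewrite QE' qexp_sumE // ltnS /e; case: (ltngtP j a) => //.
have mon_ge j x : (j < a)%N -> x \in s j -> fin (be *+ a - be *+ j) <= nu (monom Q x).
  (* The equality of values is given only for monomials with nonzero coefficient; the others have
     infinite value. *)
  move=> ja xs; have [x0|/eqP x0] := eqVneq x.1 0.
    by rewrite /monom x0 mul0r valp0 inf_le_top.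
  have := sv j x ja xs x0; rewrite valpM !valpX m_be !fin_mulrn => E.
  by rewrite fin_leB E.
have sum_ge j : (j < a)%N -> fin (be *+ a - be *+ j) <= nu (sum_monom Q (s j)).
  by move=> ja; apply: valp_sum_monom_ge => x; apply: mon_ge.
split=> //.
- rewrite QE' (size_sum_monic_powers (a := (size (Q m)).-1) (key_monic m)).
  + by rewrite /e ltnn eqxx size_poly1.
  + by rewrite prednK // ltnW.
  + by move=> j; rewrite -ltnS prednK // ltnW.
  + by rewrite /e ltnn eqxx oner_eq0.
apply/polyP => j; rewrite coef_gpoly // cE /e /relation_poly.
pose C k := \sum_(x <- s k) inp v x.1%:P * inp v (Qprod Q x.2).
have -> : \sum_(k < a) (C k)%:P * 'X^k = \poly_(k < a) C k.
  by rewrite poly_def; apply: eq_bigr => k _; rewrite mul_polyC.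
rewrite coefD coefXn coef_poly /C.
case: (ltngtP j a) => [ja|ja|->]; rewrite ?add0r ?addr0 ?homp0 //.
  rewrite homp_sum_monom => [|x]; last exact: mon_ge.
  apply: eq_big_seq => x xs; rewrite -inpM; have [x0|/eqP x0] := eqVneq x.1 0.
    rewrite /monom x0 mul0r homp0; apply/esym/init_eq0.
    by rewrite rmorph0.
  have := sv j x ja xs x0; rewrite valpM !valpX m_be !fin_mulrn => E.
  rewrite homp_inp //; case: (nu _) E => // y; rewrite inf_addE => -[<-].
  by rewrite addrK.
by rewrite subrr rmorph1 homclass1.
Qed.

Lemma succ_size : size (Q l) = ((size (Q m)).-1 * a).+1.
Proof. by have [s []] := relation. Qed.

Lemma succ_trunc_ge : trunc_ge v (Q m) (fin (be *+ a)) (Q l).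
Proof.
have [s [sum_ge _ cE _ _]] := relation => j.
rewrite /term_value cE; case: ltngtP => [ja|_|->].
- by have := sum_ge j ja; rewrite fin_leB m_be fin_mulrn.
- by rewrite valp0 inf_le_top.
by rewrite valp1 add0r m_be fin_mulrn.
Qed.

Lemma succ_rho_monic : rho \is monic.
Proof. by have [s [_ _ _ -> mr]] := relation; have [? _ _] := mr. Qed.

Lemma succ_rho_size : size rho = a.+1.
Proof.
have [s [_ _ cE _ _]] := relation.
apply/eqP; rewrite eqn_leq; apply/andP; split.
  apply/leq_sizeP => j aj; rewrite coef_gpoly // cE.
  by rewrite ltnNge ltnW //= gtn_eqF // homp0.
rewrite ltnNge; apply/negP => /leq_sizeP/(_ a (leqnn a)).
rewrite coef_gpoly // cE ltnn eqxx subrr rmorph1 homclass1.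
by apply/eqP; rewrite oner_eq0.
Qed.

(** [inp v (Q m)] is a root of [rho], which by [horner_gpoly] means that the class of [Q l] in
    degree [be *+ a] vanishes. *)
Lemma succ_value_gt : fin (be *+ a) < nu (Q l).
Proof.
have [s [_ _ _ rE [_ _ /eqP]]] := relation; rewrite -rE.
by rewrite (horner_gpoly m1 m_be succ_trunc_ge) homclass_eq0 //;
  apply: trunc_ge_val succ_trunc_ge.
Qed.

(* A jump of the value would yield a relation of [inp v (Q m)] of degree less
   than that of the minimal one. *)
Lemma succ_exact f : (size f < size (Q l))%N -> exact v (Q m) f.
Proof.
move=> fl; have [->|f0] := eqVneq f 0; first exact: trunc_ge0.
have [b [bf fb]] := trunc_attained m1 m_be f0.
have := trunc_ge_val m1 bf; rewrite le_eqVlt => /orP[/eqP E|lt].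
  by rewrite /exact -E.
case/negP: fb; apply/eqP.
have [s [_ _ _ rE [_ _ _ least]]] := relation; rewrite -rE in least; apply: least.
(* The coefficients lie in [init_alg] itself, so 1 serves as denominator. *)
- move=> j; exists ((gpoly v (Q m) be b f)`_j), 1; split.
  + rewrite coef_gpoly //; apply: init_alg_hom; last exact: trunc_ge_fin.
    by case: m_reg => _ _ F2 _; apply: F2; apply: size_qexp.
  + exact: subring_gen_1.
  + by apply/eqP; rewrite oner_eq0.
  + exists 0, 1; rewrite homclass1 Defs.val1; split=> //.
  + by rewrite mulr1.
- by apply/eqP; rewrite horner_gpoly // homclass_gt.
rewrite succ_rho_size ltnS; apply/leq_sizeP => j aj.
by rewrite coef_gpoly // (qexp_small m1 _ aj) ?homp0 // -ltnS -succ_size.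
Qed.

Lemma succ_not_exact : ~ exact v (Q m) (Q l).
Proof.
move=> /(_ a); rewrite /term_value; have [s [_ _ -> _ _]] := relation.
rewrite ltnn eqxx valp1 add0r m_be fin_mulrn; apply/negP.
by rewrite -ltNge succ_value_gt.
Qed.

End SuccessorKey.
Lemma key_value_fin l : exists be, nu (Q l) = fin be.
Proof. exact: valp_fin (key_neq0 l). Qed.

(** After splitting, the free part has degree below that of [Q m], and the power of [Q m] has
    exponent at most [alpha l - 1]. *)
Lemma size_Qprod_lt l g : (exists m, plus_pred alpha m l) ->
  (forall m, plus_pred alpha m l ->
    regular m /\ size (Q l) = ((size (Q m)).-1 * alpha l).+1) ->
  free_standard alpha l g -> (size (Qprod Q g) < size (Q l))%N.
Proof.
move=> ex H /(split_standard (key_alpha_gt0) ex)[m [ml gm g's]].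
have [[m1 F1 _ _] szl] := H m ml; rewrite (Qprod_split Q g m) szl ltnS.
have [->|p0] := eqVneq (Qprod Q [fsfun g with m |-> 0%N]) 0.
  by rewrite mul0r size_poly0.
have rm : size (Q m) = (size (Q m)).-1.+1 by rewrite prednK // ltnW.
rewrite (size_mul_monic_exp _ (key_monic m) rm p0).
have := F1 _ g's; rewrite {1}rm ltnS => lt.
apply: leq_trans (_ : _ <= (size (Q m)).-1 + (size (Q m)).-1 * g m)%N _.
  by rewrite leq_add2r.
by rewrite -mulnS leq_mul2l gm orbT.
Qed.

Lemma regular_bot : regular \bot%O.
Proof.
have QX : Q \bot%O = 'X := pk_bot (kp_pre key).
have g0 g : free_standard alpha \bot%O g -> Qprod Q g = 1.
  move=> /free_standard_bot g0; rewrite /Qprod big1 // => i _.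
  by rewrite g0 expr0.
have s0 : free_standard alpha \bot%O ([fsfun] : expo).
  split; last by rewrite fsfunE.
  split=> [i|i i'|i i' j k _ _ _ _]; rewrite ?fsfunE // => ib.
  by have := le0x i; rewrite leNgt ib.
rewrite /regular QX size_polyX; split=> // [g /g0 ->|f f2|].
- by rewrite size_poly1.
- have [c ->] : exists c : K, f = c%:P by exists f`_0; apply: size1_polyC.
  exists [:: (c, [fsfun] : expo)]; last first.
    by rewrite /sum_monom big_seq1 /monom g0 // mulr1.
  split=> // [m|]; first by rewrite inE => /eqP ->.
  rewrite /sum_monom !big_cons !big_nil addr0.
  have le : nu (monom Q (c, [fsfun] : expo)) <= \top%O by apply: inf_le_top.
  by rewrite minEle le.
move=> f g f0 g0' f2 g2; rewrite divp_small ?mul0r ?valp0.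
  by have [b ->] := valp_fin v (mulf_neq0 f0 g0').
rewrite size_polyX; apply: leq_ltn_trans (size_polyMleq _ _) _.
have H x y : (x < 2 -> y < 2 -> (x + y).-1 < 2)%N by lia.
by rewrite size_polyX in f2 g2; apply: H.
Qed.

Lemma regular_succ m l : is_succ m l -> regular m -> regular l.
Proof.
move=> ml mr; have [m1 F1 F2 mk] := mr; have [be m_be] := key_value_fin m.
have szl := succ_size ml mr m_be.
have l1 : (1 < size (Q l))%N.
  by rewrite szl ltnS muln_gt0 (key_alpha_gt0) -subn1 subn_gt0 m1.
split=> // [g|f fl|].
- apply: size_Qprod_lt; first by exists m; left.
  move=> m' [S|[_ O]]; last by case: (omega_not_succ O ml).
  by rewrite -(succ_predI ml S).
- apply: glue_expansion szl (succ_exact ml mr m_be fl) fl => //.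
  by left.
apply: is_key_step l1 _ => f g h h' fl gl hl hl'; exists (Q m), be.
split; first by split=> //; apply: (succ_not_exact ml mr m_be).
by split; apply: (succ_exact ml mr m_be).
Qed.

(** * The limit step *)

Section LimitKey.
Variable l : L.
Hypotheses (l_gt : (\bot < l)%O) (l_lim : forall k, ~ is_succ k l).
Hypotheses (l_max : ~ maximal l) (l_reg : forall m, (m < l)%O -> regular m).

Let plus_l m := inessential alpha (@whole d L) m /\ is_add_omega m l.

Let plus_lP m : plus_l m <-> is_plus alpha (@whole d L) m l.
Proof.
split=> [[I O]|]; last exact: is_plus_whole_limit.
by split=> //; left.
Qed.

Let reg m : plus_l m -> regular m.
Proof. by move=> [_ /omega_lt /l_reg]. Qed.

Let limit_size m : plus_l m -> size (Q l) = ((size (Q m)).-1 * alpha l).+1.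
Proof.
move=> pm; have := pk_degree (kp_pre key) l_max l_gt (omega_lt pm.2) ((plus_lP m).1 pm).
by rewrite mulnC => <-; rewrite prednK // size_poly_gt0 (key_neq0).
Qed.

(** Past an inessential index every [alpha] is 1, so each step keeps the degree and, by
    [succ_value_gt], raises the value. *)
Let chain m t k : plus_l m -> is_add m t k ->
  size (Q k) = size (Q m) /\ nu (Q m) <= nu (Q k).
Proof.
move=> [I O]; elim: t k => [|t IH] k; first by move=> /= ->.
move=> mk; have [j [mj jk]] := mk; have [sz le] := IH j mj.
have jr : regular j.
  by apply: l_reg; have [j' [/(is_add_inj mj) <-]] := O.1 t.
have [be j_be] := key_value_fin j.
have a1 : alpha k = 1%N by apply: inessential_unshift I mk.
split.
  rewrite (succ_size jk jr j_be) a1 muln1 -sz prednK //.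
  by rewrite size_poly_gt0 (key_neq0).
apply: le_trans le _; have := succ_value_gt jk jr j_be.
by rewrite a1 mulr1n -j_be => /ltW.
Qed.

(** Allows finitely many polynomials, each exact at an index of its own, to be exact at a common
    later one. *)
Let exact_up m m' f : plus_l m -> plus_l m' -> (m <= m')%O ->
  exact v (Q m) f -> exact v (Q m') f.
Proof.
move=> pm pm' mm'; have [t mt] := omega_between pm.2 mm' (omega_lt pm'.2).
have [sz le] := chain pm mt; have [m1 _ _ _] := reg pm; have [_ _ _ mk] := reg pm'.
exact: exact_same_size (key_monic m) (key_monic m') (esym sz) m1 mk le.
Qed.

Let expansion_exists m f : plus_l m -> exists c, expansion v alpha Q m c f.
Proof.
move=> /reg[m1 _ F2 _]; exists (mkseq (qexp (Q m) f) (size f)).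
split; rewrite ?/comb size_mkseq; first move=> j jf.
  by rewrite nth_mkseq //; apply: F2; apply: size_qexp.
rewrite {1}(qexp_sum f m1); apply: eq_bigr => j _.
by rewrite nth_mkseq.
Qed.

Let expansion_coef m c f j : plus_l m -> expansion v alpha Q m c f ->
  qexp (Q m) f j = c`_j.
Proof.
move=> pm [ce ->]; have [m1 _ _ _] := reg pm; rewrite /comb qexp_sumE //.
  by case: ltnP => // cj; rewrite nth_default.
move=> k /ce; apply: free_expansion_size; exact: reg.
Qed.

Let exact_expansion m c f : plus_l m -> expansion v alpha Q m c f ->
  (exact v (Q m) f <-> nu f <= min_value v Q m c).
Proof.
move=> pm ce; split=> [ef|le j].
  apply: le_bigmin => [|j _]; first exact: inf_le_top.
  by rewrite -(expansion_coef _ pm ce) -term_valueE.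
rewrite /term_value (expansion_coef _ pm ce) -valpX -valpM.
case: (ltnP j (size c)) => [jc|/(nth_default 0) ->].
  by apply: le_trans le _; apply: (bigmin_le _ (Ordinal jc)).
by rewrite mul0r valp0 inf_le_top.
Qed.

(** A polynomial exact at no [m] with [m+ = l] has a value jump at each of them, and [Q l] has least
    degree among such polynomials. *)
Let limit_exact f : (size f < size (Q l))%N -> exists m, plus_l m /\ exact v (Q m) f.
Proof.
move=> fl; have [_ _ _ least _] := kp_limit key l_gt l_lim; apply: NNPP => N.
suff : (size (Q l) <= size f)%N by rewrite leqNgt fl.
apply: least => m /plus_lP pm; split; first exact: expansion_exists.
move=> c ce; rewrite ltNge; apply/negP => le; apply: N.
by exists m; split=> //; apply/(exact_expansion pm ce).
Qed.

Let limit_not_exact m : plus_l m -> ~ exact v (Q m) (Q l).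
Proof.
move=> pm; have [_ _ jump _ _] := kp_limit key l_gt l_lim.
have [[c ce] H] := jump m ((plus_lP m).1 pm).
by move=> /(exact_expansion pm ce); rewrite leNgt (H c ce).
Qed.

Let limit_exact4 f1 f2 f3 f4 :
  (size f1 < size (Q l))%N -> (size f2 < size (Q l))%N ->
  (size f3 < size (Q l))%N -> (size f4 < size (Q l))%N ->
  exists m, plus_l m /\ [/\ exact v (Q m) f1, exact v (Q m) f2,
    exact v (Q m) f3 & exact v (Q m) f4].
Proof.
have upper m m' : plus_l m -> plus_l m' ->
    exists k, [/\ plus_l k, (m <= k)%O & (m' <= k)%O].
  by move=> pm pm'; case: (leP m m') => [mm'|/ltW m'm]; [exists m' | exists m].
move=> /limit_exact[m1 [p1 e1]] /limit_exact[m2 [p2 e2]].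
move=> /limit_exact[m3 [p3 e3]] /limit_exact[m4 [p4 e4]].
have [k [pk k1 k2]] := upper _ _ p1 p2.
have [k' [pk' k3 k4]] := upper _ _ p3 p4.
have [n [pn nk nk']] := upper _ _ pk pk'.
exists n; split=> //; split.
- exact: exact_up p1 pn (le_trans k1 nk) e1.
- exact: exact_up p2 pn (le_trans k2 nk) e2.
- exact: exact_up p3 pn (le_trans k3 nk') e3.
- exact: exact_up p4 pn (le_trans k4 nk') e4.
Qed.

Lemma regular_limit : regular l.
Proof.
have [[i0 /plus_lP p0] _ _ _ _] := kp_limit key l_gt l_lim.
have l1 : (1 < size (Q l))%N.
  have [m1 _ _ _] := reg p0.
  by rewrite (limit_size p0) ltnS muln_gt0 (key_alpha_gt0) -subn1 subn_gt0 m1.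
split=> // [g|f fl|].
- apply: size_Qprod_lt; first by exists i0; right.
  by move=> m [/l_lim//|pm]; split; [apply: reg | apply: limit_size].
- have [m [pm em]] := limit_exact fl.
  by apply: glue_expansion (limit_size pm) em fl => //; [right | apply: reg].
apply: is_key_step l1 _ => f g h h' fl gl hl hl'.
have [m [pm e4]] := limit_exact4 fl gl hl hl'.
have [be m_be] := key_value_fin m; have [m1 _ _ mk] := reg pm.
by exists (Q m), be; split=> //; split=> //; apply: limit_not_exact.
Qed.

End LimitKey.

Hypothesis L_wo : well_ordered L.

(** A least counterexample up to [i] would be the bottom, a successor or a limit. The presence of
    [i1] makes all these indices non-maximal, which gives access to the degree formula at limits. *)
Lemma key_regular i i1 : is_succ i i1 -> regular i.
Proof.
move=> ii1; have nmax l : (l <= i)%O -> ~ maximal l.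
  by move=> li /(_ i1); rewrite leNgt (le_lt_trans li ii1.1).
suff H l : (l <= i)%O -> regular l by apply: H.
move=> li0; apply: NNPP => N.
have [|m [mi mN] least] := L_wo (P := fun l => (l <= i)%O /\ ~ regular l).
  by exists l.
have reg k : (k < m)%O -> regular k.
  move=> km; apply: NNPP => kN; suff : (m <= k)%O by rewrite leNgt km.
  by apply: least; split=> //; apply: le_trans (ltW km) mi.
case: mN; have [[k km]|no_pred] := classic (exists k, is_succ k m).
  exact: regular_succ km (reg k km.1).
have [->|m0] := eqVneq m \bot%O; first exact: regular_bot.
apply: regular_limit => //; last exact: nmax.
  by rewrite lt_def m0 le0x.
by move=> k km; apply: no_pred; exists k.
Qed.

End KeyInduction.

Lemma polyC1_X_add (R : nzRingType) (c : R) :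
  1%:P * 'X^1 + c%:P * 'X^0 = 'X + c%:P :> {poly R}.
Proof. by rewrite polyC1 mul1r expr1 expr0 mulr1. Qed.

(** * Truncation, delta and initial form in terms of [gpoly] *)

Section TruncationFacts.
Context {K : fieldType} {G : oagType}.
Variable v : valuation {fraction {poly K}} G.
Context {d : Order.disp_t} {L : bOrderType d}.
Variables (Q : L -> {poly K}) (i : L) (h : {poly K}) (be b : G).
Local Notation nu := (valp v).
Hypotheses (q1 : (1 < size (Q i))%N) (q_be : nu (Q i) = fin be).
Local Notation P := (gpoly v (Q i) be b h).
Hypotheses (bh : trunc_ge v (Q i) (fin b) h) (P0 : P != 0).

Lemma truncationE : truncation v Q i h = fin b.
Proof.
have lead : term_value v (Q i) h (size P).-1 = fin b.
  by apply: (gpoly_coef_neq0 q1 q_be bh); rewrite -lead_coefE lead_coef_eq0.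
have Ph : ((size P).-1 < size h)%N.
  by rewrite prednK ?size_poly_gt0 //; apply: size_poly.
apply/le_anti/andP; split.
  by rewrite -lead; apply: (bigmin_le _ (Ordinal Ph)).
by apply: le_bigmin => [|j _]; [apply: inf_le_top | apply: bh].
Qed.

Lemma in_supportE j : in_support v Q i h j = (P`_j != 0).
Proof.
rewrite /in_support truncationE; apply/andP/idP => [[dj /eqP E]|Pj].
  by rewrite (coef_gpoly_inp q1 q_be E); apply: inp_neq0.
have E := gpoly_coef_neq0 q1 q_be bh Pj; split; last exact/eqP.
by apply: contra_eq_neq E => z; rewrite /term_value z valp0.
Qed.

Lemma deltaE : delta v Q i h = (size P).-1.
Proof.
apply/eqP; rewrite eqn_leq; apply/andP; split.
  apply/bigmax_leqP => j; rewrite in_supportE => Pj.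
  rewrite -ltnS prednK ?size_poly_gt0 // ltnNge; apply: contra Pj => jP.
  by rewrite nth_default.
have Ph : ((size P).-1 < size h)%N.
  by rewrite prednK ?size_poly_gt0 //; apply: size_poly.
apply: (leq_bigmax_cond (F := fun j : 'I_(size h) => j : nat) (Ordinal Ph)).
by rewrite in_supportE -lead_coefE lead_coef_eq0.
Qed.

Lemma trunc_initE : trunc_init v Q i h = P.
Proof.
rewrite /trunc_init big_mkcond.
pose E j := if in_support v Q i h j then inp v (qexp (Q i) h j) else 0.
have -> : (\sum_(j < size h) if in_support v Q i h j
    then (inp v (qexp (Q i) h j))%:P * 'X^j else 0) = \poly_(j < size h) E j.
  rewrite poly_def; apply: eq_bigr => j _; rewrite /E.
  by case: ifP => _; rewrite ?scale0r // mul_polyC.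
apply/polyP => j; rewrite coef_poly /E; case: ltnP => [jh|hj].
  rewrite in_supportE; case: eqP => // /eqP Pj.
  by rewrite (coef_gpoly_inp q1 q_be (gpoly_coef_neq0 q1 q_be bh Pj)).
by rewrite coef_gpoly // (qexp_big q1 hj) homp0.
Qed.

End TruncationFacts.

Lemma truncation0 (K : fieldType) (G : oagType) (v : valuation {fraction {poly K}} G)
  (d : Order.disp_t) (L : bOrderType d) (Q : L -> {poly K}) i :
  truncation v Q i 0 = infty G.
Proof. by rewrite /truncation size_poly0 big_ord0. Qed.

Theorem proposition4p7 (K : fieldType) (G : oagType)
  (v : valuation {fraction {poly K}} G)
  (v_onto : forall b : G, exists y, v y = fin b)
  (v_rank1 : base_rank1 v)
  (v_x : fin 0 < valp v 'X)
  (d : Order.disp_t) (L : bOrderType d)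
  (L_wo : well_ordered L) (L_countable : countable_type L)
  (alpha : L -> nat) (Q : L -> {poly K})
  (key : key_polynomials v alpha Q)
  (i i1 : L) (i_succ : is_succ i i1)
  (h : {poly K}) (h_jump : truncation v Q i h < valp v h) :
  let delta_i := delta v Q i h in
  let delta_i1 := delta v Q i1 h in
  let d_i := qexp (Q i) h in
  let d_i1 := qexp (Q i1) h in
  [/\ (alpha i1 * delta_i1 <= delta_i)%N,
      delta_i1 = delta_i ->
        [/\ exists z : {poly K},
              [/\ Q i1 = Q i + z,
                  is_free_expansion v alpha Q i z &
                  trunc_init v Q i h =
                    (inp v (d_i delta_i))%:P * ('X + (inp v z)%:P) ^+ delta_i],
            (trunc_init v Q i1 h)`_delta_i = inp v (d_i delta_i) &
            inp v (d_i delta_i) = inp v (d_i1 delta_i)] &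
      delta_i1 = delta_i ->
        forall j, (delta_i < j)%N ->
          inf_sub (truncation_plus v Q i h) (truncation v Q i h) <=
          inf_sub (valp v (d_i1 j * Q i1 ^+ j)) (truncation v Q i1 h)].
Proof.
have h0 : h != 0.
  apply: contraTneq h_jump => ->; rewrite truncation0 -leNgt.
  exact: inf_le_top.
have reg := key_regular key L_wo i_succ; have [q1 _ _ q_key] := reg.
have [be q_be] := key_value_fin key i; have [be' r_be] := key_value_fin key i1.
have a0 := key_alpha_gt0 key i1.
have r_size := succ_size key i_succ reg q_be.
have r_ge := succ_trunc_ge key i_succ reg q_be.
have rho_monic := succ_rho_monic key i_succ reg q_be.
have rho_size := succ_rho_size key i_succ reg q_be.
have be_lt : be *+ alpha i1 < be'.
  by rewrite -inf_ltE -r_be; apply: (succ_value_gt key i_succ reg q_be).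
have r_exact := succ_exact key i_succ reg q_be.
have r1 : (1 < size (Q i1))%N.
  by rewrite r_size ltnS muln_gt0 a0 -subn1 subn_gt0 q1.
have [b [bh P0]] := trunc_attained q1 q_be h0.
have [b' [b'h P'0]] := trunc_attained r1 r_be h0.
have tE := truncationE q1 q_be bh P0; have t'E := truncationE r1 r_be b'h P'0.
have dE := deltaE q1 q_be bh P0; have d'E := deltaE r1 r_be b'h P'0.
have nE : size (gpoly v (Q i) be b h) = (delta v Q i h).+1.
  by rewrite dE prednK // size_poly_gt0.
have n'E : size (gpoly v (Q i1) be' b' h) = (delta v Q i1 h).+1.
  by rewrite d'E prednK // size_poly_gt0.
(* The jump makes [inp v (Q i)] a root of the initial form, which is nonzero and hence cannot be
   constant. *)
have n_gt0 : (0 < delta v Q i h)%N.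
  rewrite lt0n; apply/negP => /eqP n0; rewrite n0 in nE.
  have PE := size1_polyC (_ : (size (gpoly v (Q i) be b h) <= 1)%N).
  have := horner_gpoly q1 q_be bh; rewrite PE ?nE // hornerC.
  rewrite homclass_gt; last by move: h_jump; rewrite tE.
  by move=> P00; move: P0; rewrite PE ?nE // P00 eqxx.
have le_n := next_degree_le q1 q_be q_key a0 r_size r_be be_lt r_ge rho_monic
  rho_size r_exact bh b'h nE n'E.
move=> delta_i delta_i1 d_i d_i1; rewrite -/delta_i -/delta_i1 in n_gt0 le_n nE n'E.
have a1 : delta_i1 = delta_i -> alpha i1 = 1%N.
  move=> E; apply/eqP; rewrite eqn_leq a0 andbT.
  by move: le_n; rewrite E -{2}(mul1n delta_i) leq_pmul2r.
split=> // [E|E j nj].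
  have [gE inE tn] := next_gpoly_power q1 q_be q_key a0 r_size r_be be_lt r_ge
    rho_monic rho_size r_exact bh b'h nE n'E (a1 E) E.
  split=> //; last first.
    by rewrite (trunc_initE r1 r_be b'h P'0) (coef_gpoly_inp r1 r_be tn) -inE.
  have [s [se QE _ _]] := kp_successor key i_succ.
  rewrite (a1 E) expr1 big_ord1 expr0 mulr1 in QE se.
  exists (sum_monom Q (s 0%N)); split=> //; first by exists (s 0%N) => //; apply: se.
  rewrite (trunc_initE q1 q_be bh P0) gE; congr (_ * _ ^+ _).
  set z := sum_monom Q (s 0%N) in QE *.
  have z_size : (size z < size (Q i))%N.
    by apply: (free_expansion_size reg); exists (s 0%N) => //; apply: se.
  (* [Q i1] has a larger value than [Q i], so their difference [z] has the value of [Q i] and its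
     class in degree [be] is its initial form. *)
  have zv : valp v z = fin be.
    rewrite (_ : z = - Q i + Q i1); last by rewrite QE addKr.
    have lt : valp v (- Q i) < valp v (Q i1).
      by rewrite valpN q_be r_be inf_ltE; have := be_lt; rewrite (a1 E).
    by rewrite valp_addl // valpN.
  rewrite (a1 E) mulr1n QE.
  have -> : Q i + z = 1 * Q i ^+ 1 + z * Q i ^+ 0.
    by rewrite mul1r expr1 expr0 mulr1.
  have s1 : (size (1%R : {poly K}) < size (Q i))%N by rewrite size_poly1.
  have ge1 : trunc_ge v (Q i) (fin be) (1 * Q i ^+ 1).
    by apply/(trunc_ge_mono v q1 _ _ s1); rewrite valp1 add0r q_be.
  have gez : trunc_ge v (Q i) (fin be) (z * Q i ^+ 0).
    by apply/(trunc_ge_mono v q1 _ _ z_size); rewrite addr0 zv.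
  rewrite (gpolyD q1 q_be ge1 gez) !gpoly_mono // mulr1n mulr0n subr0 subrr.
  rewrite (homp_inp zv) rmorph1 homclass1.
  exact: polyC1_X_add.
rewrite tE t'E -term_valueE.
apply: (next_term_ge q1 q_be q_key a0 r_size r_be be_lt r_ge rho_monic rho_size
  r_exact bh b'h nE n'E (a1 E) E nj) => k nk.
(* [truncation_plus] only ranges over [k < size h]; the later terms have zero coefficient and
   infinite value. *)
case: (ltnP k (size h)) => [kh|hk]; last first.
  by rewrite /term_value (qexp_big q1 hk) valp0 inf_le_top.
by rewrite term_valueE; apply: (bigmin_le_cond _ _ (j := Ordinal kh)).
Qed.
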